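(* For any real hyperplane arrangement $A$ (a finite set of affine hyperplanes in $\mathbf{R}^n$), the associated nonseparated scheme $X_A$ admits an algebraic cell decomposition.
   Context: **The scheme $X_A$.** $\mathrm{Ch}(A)$ is the set of chambers of $A$, i.e. connected components of $\mathbf{R}^n \setminus \bigcup_{H \in A} H$. For $C, D \in \mathrm{Ch}(A)$, $\mathrm{Sep}(C,D) \subseteq A$ is the set of hyperplanes $H \in A$ such that $C$ and $D$ lie in different connected components of $\mathbf{R}^n \setminus H$. For each $C \in \mathrm{Ch}(A)$ let $X_C = \mathbb{A}^n$ over $\operatorname{Spec}(\mathbf{R})$, and for $C, D \in \mathrm{Ch}(A)$ let $X_{CD} = \mathbb{A}^n \setminus \bigcup_{H \in \mathrm{Sep}(C,D)} H \subseteq X_C$. The scheme $X_A$ is obtained by gluing the schemes $X_C$ along the isomorphisms $X_{CD} \cong X_{DC}$ given by the identity map of $\mathbb{A}^n$; the cocycle condition holds because $\mathrm{Sep}(C,E) \subset \mathrm{Sep}(C,D) \cup \mathrm{Sep}(D,E)$. **Algebraic cell decomposition.** An algebraic cell decomposition of a scheme $X$ is a filtration of $X$ by open subschemes $$\varnothing = U^{(0)} \subset U^{(1)} \subset \dots \subset U^{(t)} = X$$ such that for each $i$ (with $1 \le i \le t$) there is an isomorphism $U^{(i)} \setminus U^{(i-1)} \cong \mathbb{A}^{d_i}$ for some $d_i \ge 0$ (the difference being given its reduced closed subscheme structure in $U^{(i)}$). *)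

(* Defs.v *)
From HB Require Import structures.
From mathcomp Require Import all_boot all_order all_algebra ring_quotient.
From mathcomp Require Import mpoly.
From mathcomp Require Import all_classical reals topology.
From mathcomp Require Import ring.

Set Implicit Arguments.
Unset Strict Implicit.
Unset Printing Implicit Defensive.

Import GRing.Theory.
Import numFieldTopology.Exports.

Local Open Scope quotient_scope.
Local Open Scope classical_set_scope.
Local Open Scope ring_scope.

Definition invertible (A : comNzRingType) (a : A) : Prop := exists b, a * b = 1.

Definition local_ring (A : comNzRingType) : Prop :=
  forall a b : A, invertible (a + b) -> invertible a \/ invertible b.

Section LocalRing.
Variable A : comNzRingType.
Implicit Types a b : A.

Lemma invertible1 : invertible (1 : A).
Proof. by exists 1; rewrite mulr1. Qed.

Lemma invertible0 : ~ invertible (0 : A).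
Proof. by case=> b /eqP; rewrite mul0r eq_sym oner_eq0. Qed.

Lemma invertibleMr a b : invertible (a * b) -> invertible b.
Proof. by case=> c abc; exists (a * c); rewrite mulrCA mulrA. Qed.

Lemma invertibleMl a b : invertible (a * b) -> invertible a.
Proof. by rewrite mulrC; apply: invertibleMr. Qed.

Lemma invertibleN a : invertible (- a) -> invertible a.
Proof. by case=> c h; exists (- c); rewrite mulrN -mulNr. Qed.

Lemma local_ring1D a : local_ring A -> ~ invertible a -> invertible (1 + a).
Proof.
move=> /(_ (1 + a) (- a)); rewrite addrK => /(_ invertible1)[//|].
by move/invertibleN.
Qed.

End LocalRing.

(* A sheaf of local rings is given by its étalé space: sections over an open  *)
(* set U are functions sending x in U to a germ in the stalk at x, and        *)
(* [regular s x] means that s is a section on some neighbourhood of x (so the *)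
(* sections over U are the functions regular at every point of U, and the     *)
(* values outside U are junk).  The last two fields say that the value at x   *)
(* of a section is its germ at x.  The maps [const x] give the structural     *)
(* morphism to Spec k.                                                        *)
Record lrspace (k : comNzRingType) := LRSpace {
  point :> topologicalType;
  stalk : point -> comNzRingType;
  const : forall x, {rmorphism k -> stalk x};
  regular : (forall x, stalk x) -> set point;
  stalk_local : forall x, local_ring (stalk x);
  regular_open : forall s, open (regular s);
  regular_near : forall s t x,
    (\forall y \near x, s y = t y) -> regular s x -> regular t x;
  regular_const : forall c x, regular (fun y => const y c) x;
  regularB : forall s t x,
    regular s x -> regular t x -> regular (fun y => s y - t y) x;
  regularM : forall s t x,
    regular s x -> regular t x -> regular (fun y => s y * t y) x;
  regular_germ : forall x (a : stalk x), exists2 s, regular s x & s x = a;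
  regular_germ_inj : forall s t x, regular s x -> regular t x ->
    s x = t x -> \forall y \near x, s y = t y
}.

Arguments stalk {k X} x : rename.
Arguments const {k X} x : rename.
Arguments regular {k X} s x : rename.

(* Isomorphism over Spec k: a homeomorphism with ring isomorphisms on stalks  *)
(* (automatically local) that identify the sections of the two sheaves and    *)
(* commute with the structural morphisms.                                     *)
Definition lriso (k : comNzRingType) (X Y : lrspace k) : Prop :=
  exists (f : X -> Y) (g : Y -> X)
         (phi : forall x, {rmorphism stalk (f x) -> stalk x}),
    [/\ [/\ continuous f, continuous g, cancel f g & cancel g f],
        forall x, bijective (phi x),
        forall x c, phi x (const (f x) c) = const x c &
        forall (t : forall y : Y, stalk y) x,
          regular t (f x) <-> regular (fun z => phi z (t (f z))) x].

(* The topological space Y with the inverse image of the structure sheaf of X.*)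
Section InverseImage.
Variables (k : comNzRingType) (X : lrspace k) (Y : topologicalType).
Variables (f : Y -> X) (fC : continuous f).

Definition inv_regular (s : forall y, stalk (f y)) : set Y :=
  [set y | exists2 t : forall x : X, stalk x,
     regular t (f y) & \forall z \near y, s z = t (f z)].

Lemma inv_regular_open s : open (inv_regular s).
Proof.
rewrite openE => y [t rt st].
have rt' : \forall z \near y, regular t (f z).
  by apply: fC; apply: open_nbhs_nbhs; split => //; exact: regular_open.
by near=> z; exists t; near: z => //; exact: near_join.
Unshelve. all: by end_near. Qed.

Lemma inv_regular_near (s t : forall y, stalk (f y)) y :
  (\forall z \near y, s z = t z) -> inv_regular s y -> inv_regular t y.
Proof. by move=> st [u ru su]; exists u => //; apply: filterS2 st su => z ->. Qed.

Lemma inv_regular_const c y : inv_regular (fun z => const (f z) c) y.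
Proof.
by exists (fun x => const x c); [exact: regular_const|exact: nearW].
Qed.

Lemma inv_regularB s t y :
  inv_regular s y -> inv_regular t y -> inv_regular (fun z => s z - t z) y.
Proof.
move=> [u ru su] [v rv tv]; exists (fun x => u x - v x); first exact: regularB.
by apply: filterS2 su tv => z -> ->.
Qed.

Lemma inv_regularM s t y :
  inv_regular s y -> inv_regular t y -> inv_regular (fun z => s z * t z) y.
Proof.
move=> [u ru su] [v rv tv]; exists (fun x => u x * v x); first exact: regularM.
by apply: filterS2 su tv => z -> ->.
Qed.

Lemma inv_regular_germ y (a : stalk (f y)) :
  exists2 s, inv_regular s y & s y = a.
Proof.
have [t rt ta] := regular_germ a.
by exists (fun z => t (f z)) => //; exists t => //; exact: nearW.
Qed.

Lemma inv_regular_germ_inj s t y : inv_regular s y -> inv_regular t y ->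
  s y = t y -> \forall z \near y, s z = t z.
Proof.
move=> [u ru su] [v rv tv] sty.
have uv : u (f y) = v (f y).
  by rewrite -(nbhs_singleton su) -(nbhs_singleton tv).
have uv' : \forall z \near y, u (f z) = v (f z).
  exact: (fC (regular_germ_inj ru rv uv)).
by apply: filterS3 su tv uv' => z -> ->.
Qed.

Definition inv_image : lrspace k := @LRSpace k Y (fun y => stalk (f y))
  (fun y => const (f y)) inv_regular (fun y => @stalk_local _ X (f y))
  inv_regular_open inv_regular_near inv_regular_const inv_regularB inv_regularM
  inv_regular_germ inv_regular_germ_inj.

End InverseImage.

Definition subspace_type (T : topologicalType) (U : set T) : topologicalType :=
  set_type U.

Definition sub_incl (T : topologicalType) (U : set T) :
  subspace_type U -> T := set_val.

Lemma sub_incl_continuous (T : topologicalType) (U : set T) :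
  continuous (@sub_incl T U).
Proof. exact: initial_continuous. Qed.

Definition open_subspace (k : comNzRingType) (X : lrspace k) (U : set X) :
  lrspace k := inv_image (@sub_incl_continuous X U).

(* The reduced structure on a closed subset Z: the quotient of the structure  *)
(* sheaf by the sheaf of ideals of the sections vanishing on Z, a section     *)
(* vanishing at a point when its germ there lies in the maximal ideal.        *)
Section ReducedClosedSubspace.
Variables (k : comNzRingType) (X : lrspace k) (Z : set X).

Definition vanishing (z : subspace_type Z) : stalk (sub_incl z) -> bool :=
  fun a => `[< exists s : forall x : X, stalk x, [/\ regular s (sub_incl z),
      s (sub_incl z) = a &
      \forall y \near (sub_incl z : X), Z y -> ~ invertible (s y)] >].

Arguments vanishing : clear implicits.

Let noninvD (x : X) (a b : stalk x) :
  ~ invertible a -> ~ invertible b -> ~ invertible (a + b).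
Proof. by move=> na nb /stalk_local[]. Qed.

Lemma vanishing_idealr z : idealr_closed (vanishing z).
Proof.
split.
- apply/asboolP; exists (fun x => const x 0); split.
  + exact: regular_const.
  + by rewrite rmorph0.
  + by apply: nearW => y _; rewrite rmorph0; exact: invertible0.
- apply/asboolP => -[s [_ s1 /nbhs_singleton]].
  rewrite s1; apply; last exact: invertible1.
  by apply: set_mem; exact: (valP (z : set_type Z)).
- move=> a u v /asboolP[s [rs <- sZ]] /asboolP[t [rt <- tZ]].
  have [b rb <-] := regular_germ a.
  apply/asboolP; exists (fun x => b x * s x - (const x 0 - t x)); split.
  + apply: regularB; first exact: regularM.
    by apply: regularB => //; exact: regular_const.
  + by rewrite rmorph0 sub0r opprK.
  + apply: filterS2 sZ tZ => y sy ty Zy; rewrite rmorph0 sub0r opprK.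
    by apply: noninvD; [move/invertibleMr; exact: sy|exact: ty].
Qed.

HB.instance Definition _ (z : subspace_type Z) :=
  isIdealr.Build (stalk (sub_incl z)) (vanishing z) (vanishing_idealr z).

Definition red_ideal (z : subspace_type Z) : idealr (stalk (sub_incl z)) :=
  vanishing z.

Definition red_stalk (z : subspace_type Z) : comNzRingType :=
  {ideal_quot (red_ideal z)}.

Definition red_class (z : subspace_type Z) (a : stalk (sub_incl z)) :
  red_stalk z := \pi a.

Lemma red_class_is_zmod_morphism z : zmod_morphism (@red_class z).
Proof. by move=> a b; rewrite /red_class rmorphB. Qed.

Lemma red_class_is_monoid_morphism z : monoid_morphism (@red_class z).
Proof. by split=> [|a b]; rewrite /red_class ?rmorph1 ?rmorphM. Qed.

HB.instance Definition _ z := GRing.isZmodMorphism.Build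
  (stalk (sub_incl z)) (red_stalk z) (@red_class z) (@red_class_is_zmod_morphism z).
HB.instance Definition _ z := GRing.isMonoidMorphism.Build
  (stalk (sub_incl z)) (red_stalk z) (@red_class z)
  (@red_class_is_monoid_morphism z).

Lemma red_class_eq z a b : (red_class a = red_class b) <-> vanishing z (a - b).
Proof.
by rewrite /red_class; split => [/eqP|h]; [|apply/eqP]; rewrite -Quotient.idealrBE.
Qed.

Lemma red_class_surj z (q : red_stalk z) : exists a, q = red_class a.
Proof. by exists (repr q); rewrite /red_class reprK. Qed.

Definition red_const (z : subspace_type Z) : {rmorphism k -> red_stalk z} :=
  @red_class z \o const (sub_incl z).

Definition red_regular (s : forall z, red_stalk z) : set (subspace_type Z) :=
  [set z | exists2 t : forall x : X, stalk x,
     regular t (sub_incl z) &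
     \forall y \near z, s y = red_class (t (sub_incl y))].

Lemma red_local z : local_ring (red_stalk z).
Proof.
move=> a b [c]; have [{}a ->] := red_class_surj a.
have [{}b ->] := red_class_surj b; have [{}c ->] := red_class_surj c.
have inv_red (e : stalk (sub_incl z)) : invertible e -> invertible (red_class e).
  by case=> d ed; exists (red_class d); rewrite -rmorphM ed rmorph1.
rewrite -rmorphD -rmorphM -(rmorph1 (@red_class z)).
move=> /red_class_eq/asboolP[s [_ se /nbhs_singleton]].
rewrite se => /(_ (set_mem (valP (z : set_type Z)))) /(local_ring1D (@stalk_local _ _ _)).
rewrite addrC subrK => /invertibleMl /stalk_local[] /inv_red; by [left|right].
Qed.

Lemma red_regular_open s : open (red_regular s).
Proof.
rewrite openE => y [t rt st].
have rt' : \forall z \near y, regular t (sub_incl z).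
  apply: sub_incl_continuous; apply: open_nbhs_nbhs; split => //.
  exact: regular_open.
by near=> z; exists t; near: z => //; exact: (near_join st).
Unshelve. all: by end_near. Qed.

Lemma red_regular_near (s t : forall z, red_stalk z) y :
  (\forall z \near y, s z = t z) -> red_regular s y -> red_regular t y.
Proof.
by move=> st [u ru su]; exists u => //; apply: filterS2 st su => z ->.
Qed.

Lemma red_regular_const c y : red_regular (fun z => red_const z c) y.
Proof.
exists (fun x => const x c); first exact: regular_const.
exact: (@nearW _ (nbhs y)).
Qed.

Lemma red_regularB s t y :
  red_regular s y -> red_regular t y -> red_regular (fun z => s z - t z) y.
Proof.
move=> [u ru su] [v rv tv]; exists (fun x => u x - v x); first exact: regularB.
by apply: filterS2 su tv => z -> ->; rewrite rmorphB.
Qed.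

Lemma red_regularM s t y :
  red_regular s y -> red_regular t y -> red_regular (fun z => s z * t z) y.
Proof.
move=> [u ru su] [v rv tv]; exists (fun x => u x * v x); first exact: regularM.
by apply: filterS2 su tv => z -> ->; rewrite rmorphM.
Qed.

Lemma red_regular_germ y (a : red_stalk y) : exists2 s, red_regular s y & s y = a.
Proof.
have [{}a ->] := red_class_surj a; have [t rt <-] := regular_germ a.
exists (fun z => red_class (t (sub_incl z))) => //.
by exists t => //; exact: (@nearW _ (nbhs y)).
Qed.

Lemma red_regular_germ_inj s t y : red_regular s y -> red_regular t y ->
  s y = t y -> \forall z \near y, s z = t z.
Proof.
move=> [u ru su] [v rv tv] sty.
have /red_class_eq/asboolP[w [rw wuv wZ]] :
    red_class (u (sub_incl y)) = red_class (v (sub_incl y)).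
  by rewrite -(nbhs_singleton su) -(nbhs_singleton tv).
have wuv' := regular_germ_inj rw (regularB ru rv) wuv.
have uv : \forall z \near y, red_class (u (sub_incl z)) = red_class (v (sub_incl z)).
  have : \forall z \near y, [/\ regular w (sub_incl z),
      \forall x \near (sub_incl z : X), w x = u x - v x &
      \forall x \near (sub_incl z : X), Z x -> ~ invertible (w x)].
    apply: (@sub_incl_continuous X Z y [set x | [/\ regular w x,
      \forall x' \near x, w x' = u x' - v x' &
      \forall x' \near x, Z x' -> ~ invertible (w x')]]).
    have rw' : \forall x \near (sub_incl y : X), regular w x.
      by apply: open_nbhs_nbhs; split => //; exact: regular_open.
    have wuv2 := near_join wuv'; have wZ2 := near_join wZ.
    by apply: filterS3 rw' wuv2 wZ2.
  apply: filterS => z [rwz wz wZz]; apply/red_class_eq/asboolP.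
  by exists w; split => //; exact: nbhs_singleton wz.
by apply: filterS3 su tv uv => z -> ->.
Unshelve. all: by end_near. Qed.

Definition reduced_closed : lrspace k := @LRSpace k (subspace_type Z)
  red_stalk red_const red_regular red_local red_regular_open red_regular_near
  red_regular_const red_regularB red_regularM red_regular_germ
  red_regular_germ_inj.

End ReducedClosedSubspace.

Record prime_spectrum (A : comNzRingType) := PrimeIdeal {
  prime_of : A -> bool;
  prime_of_ideal : idealr_closed prime_of;
  prime_of_prime : prime_idealr_closed prime_of
}.

Coercion mem_prime (A : comNzRingType) (p : prime_spectrum A) : {pred A} :=
  prime_of p.

Section PrimeSpectrum.
Variable A : comNzRingType.
Local Notation pt := (prime_spectrum A).
Implicit Types (p q : pt) (a b f : A).

Lemma prime_spectrumP p q : prime_of p = prime_of q -> p = q.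
Proof.
by case: p q => [p pi pp] [q qi qp] /= e; subst q; congr PrimeIdeal;
  exact: Prop_irrelevance.
Qed.

HB.instance Definition _ := gen_eqMixin pt.
HB.instance Definition _ := gen_choiceMixin pt.

Lemma prime1 p : 1 \notin p. Proof. by case: (prime_of_ideal p). Qed.

Lemma prime0 p : 0 \in p. Proof. by case: (prime_of_ideal p). Qed.

Lemma primeMl p a b : b \in p -> a * b \in p.
Proof.
case: (prime_of_ideal p) => p0 _ h bp.
by rewrite -[_ * _]addr0; exact: h.
Qed.

Lemma primeM p a b : (a * b \in p) = (a \in p) || (b \in p).
Proof.
apply/idP/orP => [/prime_of_prime/orP//|[|]]; last exact: primeMl.
by rewrite mulrC; exact: primeMl.
Qed.

Lemma primeD p a b : a \in p -> b \in p -> a + b \in p.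
Proof.
case: (prime_of_ideal p) => _ _ h ap bp; rewrite -[a]mul1r; exact: h.
Qed.

Lemma primeN p a : a \in p -> - a \in p.
Proof. by rewrite -mulN1r; exact: primeMl. Qed.

Definition zeros (E : set A) : set pt := [set p : pt | forall a, E a -> a \in p].

Definition zariski_open (U : set pt) : Prop := exists E, U = ~` zeros E.

Let zariski_openT : zariski_open setT.
Proof.
exists setT; apply/seteqP; split => // p _ /(_ 1 I).
by rewrite (negPf (prime1 p)).
Qed.

Let zariski_openI : setI_closed zariski_open.
Proof.
move=> _ _ [E ->] [F ->]; exists [set c | exists a b, [/\ E a, F b & c = a * b]].
rewrite -setCU; congr (~` _); apply/seteqP; split => p.
  by case=> h _ [a [b [Ea Fb ->]]]; rewrite primeM; apply/orP; [left|right]; exact: h.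
move=> h; have [|nE] := pselect (zeros E p); [by left|right => b Fb].
have [a /not_implyP[Ea /negP ap]] : exists a, ~ (E a -> a \in p).
  exact/existsNP.
have : a * b \in p by apply: h; exists a, b.
by rewrite primeM (negPf ap).
Qed.

Let zariski_open_bigU (I : Type) (f : I -> set pt) :
  (forall i, zariski_open (f i)) -> zariski_open (\bigcup_i f i).
Proof.
move=> /choice[E fE]; exists (\bigcup_i E i); apply/seteqP; split => p.
  by case=> i _; rewrite fE => h g; apply: h => a Ea; apply: g; exists i.
move=> h; apply: contrapT => g; apply: h => a [i _ Ea].
apply: contrapT => ap; apply: g; exists i => //; rewrite fE => h.
by apply: ap; exact: h.
Qed.

HB.instance Definition _ := isOpenTopological.Build pt
  zariski_openT zariski_openI zariski_open_bigU.

Lemma open_basic f : open [set p : pt | f \notin p].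
Proof.
exists [set f]; apply/seteqP; split => p /=; first by move=> /negP h g; apply/h/g.
by move=> h; apply/negP => fp; apply: h => _ ->.
Qed.

Lemma near_basic f p : f \notin p -> \forall q \near p, f \notin (q : pt).
Proof.
by move=> fp; exact: (@open_nbhs_nbhs _ _ [set q : pt | f \notin q]
  (conj (open_basic f) fp)).
Qed.

End PrimeSpectrum.

Section Localization.
Variables (A : comNzRingType) (p : prime_spectrum A).

Definition denom := {f : A | f \notin p}.

Definition loc_equiv (x y : A * denom) : bool :=
  `[< exists2 u, u \notin p & u * (x.1 * val y.2 - y.1 * val x.2) = 0 >].

Lemma loc_equiv_is_equiv : equiv_class_of loc_equiv.
Proof.
split=> [x|x y|y x z].
- by apply/asboolP; exists 1; rewrite ?prime1// subrr mulr0.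
- by apply/asboolP/asboolP => -[u up e]; exists u => //;
    rewrite -opprB mulrN e oppr0.
- move=> /asboolP[u up e] /asboolP[v vp g]; apply/asboolP.
  exists (u * v * val y.2); first by rewrite !primeM !negb_or up vp (valP y.2).
  transitivity ((u * (x.1 * val y.2 - y.1 * val x.2)) * v * val z.2 +
     (v * (y.1 * val z.2 - z.1 * val y.2)) * u * val x.2); first by ring.
  by rewrite e g; ring.
Qed.

Canonical loc_equiv_equiv := EquivRelPack loc_equiv_is_equiv.
Canonical loc_equiv_encModRel := defaultEncModRel loc_equiv.

Definition loc := {eq_quot loc_equiv}.
HB.instance Definition _ : EqQuotient _ loc_equiv loc := EqQuotient.on loc.
HB.instance Definition _ := Choice.on loc.

Definition frac (a : A) (f : A) (fp : f \notin p) : loc :=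
  \pi_loc (a, exist _ f fp).

Lemma frac_eq a f fp b g gp : @frac a f fp = @frac b g gp <->
  exists2 u, u \notin p & u * (a * g - b * f) = 0.
Proof.
rewrite /frac; split=> [/eqP|h]; last apply/eqP; rewrite piE.
  by move/asboolP.
exact/asboolP.
Qed.

Lemma frac_surj (x : loc) : exists a f fp, x = @frac a f fp.
Proof.
by case: (repr x) (reprK x) => a [f fp] /= <-; exists a, f, fp.
Qed.

Lemma denomM f g : f \notin p -> g \notin p -> f * g \notin p.
Proof. by rewrite primeM negb_or => -> ->. Qed.

Definition loc_num (x : loc) : A := (repr x).1.
Definition loc_den (x : loc) : A := val (repr x).2.
Lemma loc_denP x : loc_den x \notin p. Proof. exact: (valP (repr x).2). Qed.

Lemma loc_fracE x : x = frac (loc_num x) (loc_denP x).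
Proof.
rewrite -[LHS]reprK /frac; congr (\pi _).
move: (loc_denP x); rewrite /loc_num /loc_den; case: (repr x) => a [f fp] /= fp'.
by congr (_, exist _ _ _); exact: bool_irrelevance.
Qed.

Definition loc_add x y := frac (loc_num x * loc_den y + loc_num y * loc_den x)
  (denomM (loc_denP x) (loc_denP y)).
Definition loc_opp x := frac (- loc_num x) (loc_denP x).
Definition loc_mul x y := frac (loc_num x * loc_num y)
  (denomM (loc_denP x) (loc_denP y)).
Definition loc_of (a : A) := frac a (prime1 p).

Lemma loc_addE a f fp b g gp : loc_add (@frac a f fp) (@frac b g gp) =
  frac (a * g + b * f) (denomM fp gp).
Proof.
have /frac_eq[u up eu] := loc_fracE (frac a fp).
have /frac_eq[v vp ev] := loc_fracE (frac b gp).
apply/frac_eq; exists (u * v); first exact: denomM.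
move: (loc_num _) (loc_den _) eu (loc_num _) (loc_den _) ev.
move=> a' f' eu b' g' ev.
transitivity (- (u * (a * f' - a' * f)) * v * g * g'
              - (v * (b * g' - b' * g)) * u * f * f'); first by ring.
by rewrite eu ev; ring.
Qed.

Lemma loc_mulE a f fp b g gp : loc_mul (@frac a f fp) (@frac b g gp) =
  frac (a * b) (denomM fp gp).
Proof.
have /frac_eq[u up eu] := loc_fracE (frac a fp).
have /frac_eq[v vp ev] := loc_fracE (frac b gp).
apply/frac_eq; exists (u * v); first exact: denomM.
move: (loc_num _) (loc_den _) eu (loc_num _) (loc_den _) ev.
move=> a' f' eu b' g' ev.
transitivity (- (u * (a * f' - a' * f)) * v * b' * g
              - (v * (b * g' - b' * g)) * u * a * f'); first by ring.
by rewrite eu ev; ring.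
Qed.

Lemma loc_oppE a f fp : loc_opp (@frac a f fp) = frac (- a) fp.
Proof.
have /frac_eq[u up eu] := loc_fracE (frac a fp).
by apply/frac_eq; exists u => //; rewrite -[RHS]eu; ring.
Qed.

Lemma frac_eq1 a f fp b g gp :
  a * g = b * f -> @frac a f fp = @frac b g gp.
Proof. by move=> e; apply/frac_eq; exists 1; rewrite ?prime1// e subrr mulr0. Qed.

Lemma loc_addA : associative loc_add.
Proof.
move=> x y z; have [a [f [fp ->]]] := frac_surj x.
have [b [g [gp ->]]] := frac_surj y; have [c [h [hp ->]]] := frac_surj z.
by rewrite !loc_addE; apply: frac_eq1; ring.
Qed.

Lemma loc_addC : commutative loc_add.
Proof.
move=> x y; have [a [f [fp ->]]] := frac_surj x.
have [b [g [gp ->]]] := frac_surj y.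
by rewrite !loc_addE; apply: frac_eq1; ring.
Qed.

Lemma loc_add0 : left_id (loc_of 0) loc_add.
Proof.
move=> x; have [a [f [fp ->]]] := frac_surj x.
by rewrite !loc_addE; apply: frac_eq1; ring.
Qed.

Lemma loc_addN : left_inverse (loc_of 0) loc_opp loc_add.
Proof.
move=> x; have [a [f [fp ->]]] := frac_surj x.
by rewrite loc_oppE !loc_addE; apply: frac_eq1; ring.
Qed.

HB.instance Definition _ := GRing.isZmodule.Build loc
  loc_addA loc_addC loc_add0 loc_addN.

Lemma loc_mulA : associative loc_mul.
Proof.
move=> x y z; have [a [f [fp ->]]] := frac_surj x.
have [b [g [gp ->]]] := frac_surj y; have [c [h [hp ->]]] := frac_surj z.
by rewrite !loc_mulE; apply: frac_eq1; ring.
Qed.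

Lemma loc_mulC : commutative loc_mul.
Proof.
move=> x y; have [a [f [fp ->]]] := frac_surj x.
have [b [g [gp ->]]] := frac_surj y.
by rewrite !loc_mulE; apply: frac_eq1; ring.
Qed.

Lemma loc_mul1 : left_id (loc_of 1) loc_mul.
Proof.
move=> x; have [a [f [fp ->]]] := frac_surj x.
by rewrite !loc_mulE; apply: frac_eq1; ring.
Qed.

Lemma loc_mulDl : left_distributive loc_mul loc_add.
Proof.
move=> x y z; have [a [f [fp ->]]] := frac_surj x.
have [b [g [gp ->]]] := frac_surj y; have [c [h [hp ->]]] := frac_surj z.
rewrite !(loc_addE, loc_mulE).
by apply: frac_eq1; ring.
Qed.

Lemma loc_1neq0 : loc_of 1 != 0.
Proof.
apply/eqP => /frac_eq[u up]; rewrite mul0r mulr1 subr0 mulr1 => u0.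
by move: up; rewrite u0 prime0.
Qed.

HB.instance Definition _ := GRing.Zmodule_isComNzRing.Build loc
  loc_mulA loc_mulC loc_mul1 loc_mulDl loc_1neq0.

Lemma fracD a f fp b g gp :
  @frac a f fp + @frac b g gp = frac (a * g + b * f) (denomM fp gp).
Proof. exact: loc_addE. Qed.

Lemma fracN a f fp : - @frac a f fp = frac (- a) fp.
Proof. exact: loc_oppE. Qed.

Lemma fracM a f fp b g gp :
  @frac a f fp * @frac b g gp = frac (a * b) (denomM fp gp).
Proof. exact: loc_mulE. Qed.

Lemma loc_of_is_zmod_morphism : zmod_morphism loc_of.
Proof.
by move=> a b; rewrite /loc_of fracN fracD; apply: frac_eq1; ring.
Qed.

Lemma loc_of_is_monoid_morphism : monoid_morphism loc_of.
Proof.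
by split=> // a b; rewrite /loc_of fracM; apply: frac_eq1; ring.
Qed.

HB.instance Definition _ := GRing.isZmodMorphism.Build A loc loc_of
  loc_of_is_zmod_morphism.
HB.instance Definition _ := GRing.isMonoidMorphism.Build A loc loc_of
  loc_of_is_monoid_morphism.

Lemma frac_invertible a f fp : invertible (@frac a f fp) <-> a \notin p.
Proof.
split=> [[y]|ap]; last first.
  exists (frac f ap); rewrite fracM; apply: frac_eq1; ring.
have [b [g [gp ->]]] := frac_surj y; rewrite fracM => /frac_eq[u up e].
apply/negP => ap; have : u * (f * g) \in p.
  have -> : u * (f * g) = b * u * a - u * (a * b * 1 - 1 * (f * g)) by ring.
  by rewrite e subr0 primeMl.
by rewrite !primeM (negPf up) (negPf fp) (negPf gp).
Qed.

Lemma loc_local : local_ring loc.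
Proof.
move=> x y; have [a [f [fp ->]]] := frac_surj x.
have [b [g [gp ->]]] := frac_surj y.
rewrite fracD => /frac_invertible h.
have [ap|ap] := boolP (a \in p); last by left; apply/frac_invertible.
right; apply/frac_invertible; apply: contra h => bp.
by apply: primeD; rewrite primeM ?ap ?bp.
Qed.

End Localization.

Section Spec.
Variables (k : comNzRingType) (A : comAlgType k).

Definition spec_regular (s : forall p : prime_spectrum A, loc p) :
    set (prime_spectrum A) :=
  [set p : prime_spectrum A | exists a f, \forall q \near p,
     exists fq : f \notin (q : prime_spectrum A), s q = frac a fq].

Definition spec_const (p : prime_spectrum A) : {rmorphism k -> loc p} :=
  @loc_of A p \o in_alg A.

Lemma spec_regular_open s : open (spec_regular s).
Proof.
rewrite openE => p [a [f sp]].
by apply: filterS (near_join sp) => q sq; exists a, f.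
Qed.

Lemma spec_regular_near (s t : forall p : prime_spectrum A, loc p) p :
  (\forall q \near p, s q = t q) -> spec_regular s p -> spec_regular t p.
Proof.
move=> st [a [f sp]]; exists a, f; apply: filterS2 st sp => q <- [fq ->].
by exists fq.
Qed.

Lemma spec_regular_const c p : spec_regular (fun q => spec_const q c) p.
Proof.
exists c%:A, 1; apply: (@nearW _ (nbhs p)) => q; exists (prime1 q).
by [].
Qed.

Lemma spec_regularB s t p : spec_regular s p -> spec_regular t p ->
  spec_regular (fun q => s q - t q) p.
Proof.
move=> [a [f sp]] [b [g tp]]; exists (a * g + (- b) * f), (f * g).
apply: filterS2 sp tp => q [fq ->] [gq ->].
by exists (denomM fq gq); rewrite fracN fracD.
Qed.

Lemma spec_regularM s t p : spec_regular s p -> spec_regular t p ->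
  spec_regular (fun q => s q * t q) p.
Proof.
move=> [a [f sp]] [b [g tp]]; exists (a * b), (f * g).
apply: filterS2 sp tp => q [fq ->] [gq ->].
by exists (denomM fq gq); rewrite fracM.
Qed.

Lemma spec_regular_germ p (x : loc p) : exists2 s, spec_regular s p & s p = x.
Proof.
have [a [f [fp ->]]] := frac_surj x.
pose s (q : prime_spectrum A) : loc q :=
  if pselect (f \notin q) is left fq then frac a fq else 0.
have sE (q : prime_spectrum A) (fq : f \notin q) : s q = frac a fq.
  rewrite /s; case: pselect => // fq'.
  by rewrite (bool_irrelevance fq' fq).
exists s; last exact: sE.
exists a, f; apply: filterS (near_basic fp) => q fq; exists fq; exact: sE.
Qed.

Lemma spec_regular_germ_inj s t p : spec_regular s p -> spec_regular t p ->
  s p = t p -> \forall q \near p, s q = t q.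
Proof.
move=> [a [f sp]] [b [g tp]].
have [fp ->] := nbhs_singleton sp; have [gp ->] := nbhs_singleton tp.
move=> /frac_eq[u up e].
apply: filterS3 sp tp (near_basic up) => q [fq ->] [gq ->] uq.
by apply/frac_eq; exists u.
Qed.

Definition spec : lrspace k := @LRSpace k (prime_spectrum A)
  (fun p => loc p) spec_const spec_regular (fun p => @loc_local A p)
  spec_regular_open spec_regular_near spec_regular_const spec_regularB
  spec_regularM spec_regular_germ spec_regular_germ_inj.

End Spec.

Definition is_scheme (k : comNzRingType) (X : lrspace k) : Prop :=
  forall x : X, exists (U : set X) (A : comAlgType k),
    [/\ open U, U x & lriso (open_subspace U) (spec A)].

Record scheme (k : comNzRingType) := Scheme {
  scheme_space :> lrspace k;
  schemeP : is_scheme scheme_space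
}.

Definition affine_space (k : comNzRingType) (n : nat) : lrspace k :=
  spec {mpoly k[n]}.

Record copies_gluing (I : choiceType) (T : topologicalType) := CopiesGluing {
  overlap :> I -> I -> set T;
  overlap_open : forall i j, open (overlap i j);
  overlap_refl : forall i, overlap i i = setT;
  overlap_sym : forall i j, overlap i j = overlap j i;
  overlap_cocycle : forall i j k,
    overlap i j `&` overlap j k `<=` overlap i k
}.

(* The space glued from copies of X indexed by I, the copies i and j being    *)
(* identified along W i j by the identity map of X.  These identity maps      *)
(* induce a map from the glued space to X, which is the identity on each      *)
(* copy, so the sheaf restricting to the structure sheaf of X on every copy   *)
(* is the inverse image sheaf.                                                *)
Section Gluing.
Variables (k : comNzRingType) (X : lrspace k) (I : choiceType).
Variable W : copies_gluing I X.

Definition copies : topologicalType := {i : I & X}.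

Definition in_copy (i : I) (x : X) : copies := existT (fun=> X : Type) i x.

Definition glue_equiv (a b : copies) : bool :=
  `[< projT2 a = projT2 b /\ W (projT1 a) (projT1 b) (projT2 a) >].

Lemma glue_equiv_is_equiv : equiv_class_of glue_equiv.
Proof.
split=> [[i x]|[i x] [j y]|[j y] [i x] [l z]].
- by apply/asboolP; rewrite /= overlap_refl.
- by apply/asboolP/asboolP => /= -[<-]; rewrite overlap_sym.
- move=> /asboolP/= [<- Wx] /asboolP/= [<- Wy]; apply/asboolP; split => //=.
  by apply: overlap_cocycle; split; [exact: Wx|exact: Wy].
Qed.

Canonical glue_equiv_equiv := EquivRelPack glue_equiv_is_equiv.
Canonical glue_equiv_encModRel := defaultEncModRel glue_equiv.

Definition glue_quotient := {eq_quot glue_equiv}.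
HB.instance Definition _ : EqQuotient _ glue_equiv glue_quotient :=
  EqQuotient.on glue_quotient.

Definition glue_point : topologicalType := quotient_topology glue_quotient.

Definition in_glue (i : I) (x : X) : glue_point :=
  \pi_glue_quotient (in_copy i x).

Definition glue_proj (c : glue_point) : X :=
  projT2 (repr (c : glue_quotient)).

Lemma in_glue_eq i j x y : in_glue i x = in_glue j y <-> x = y /\ W i j x.
Proof.
have E : (in_copy i x == in_copy j y %[mod glue_quotient]) =
    glue_equiv (in_copy i x) (in_copy j y) by rewrite piE.
split=> [h|h]; first by have /asboolP : glue_equiv (in_copy i x) (in_copy j y)
  by rewrite -E; apply/eqP.
have : glue_equiv (in_copy i x) (in_copy j y) by apply/asboolP.
by rewrite -E => /eqP.
Qed.

Lemma in_glue_surj c : exists i x, c = in_glue i x.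
Proof.
by case: (repr (c : glue_quotient)) (reprK c) => i x <-;
  exists i, x.
Qed.

Lemma in_glueK i : cancel (in_glue i) glue_proj.
Proof.
move=> x; rewrite /glue_proj.
case: (repr _) (reprK (in_glue i x : glue_quotient)) => j y.
by move=> /in_glue_eq[].
Qed.

Lemma in_glue_continuous i : continuous (in_glue i).
Proof.
move=> x; apply: continuous_comp; first exact: existT_continuous.
exact: pi_continuous.
Qed.

Lemma glue_proj_continuous : continuous glue_proj.
Proof.
apply: (@repr_comp_continuous copies glue_quotient X (fun a => projT2 a)).
  by move=> -[i x] U Ux; exact: Ux.
by move=> [i x] [j y] /eqP/in_glue_eq[-> _].
Qed.

Definition glue : lrspace k := inv_image glue_proj_continuous.

Definition chart (i : I) : set glue := range (in_glue i).

Lemma chart_open i : open (chart i).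
Proof.
rewrite /open/= /quotient_open; apply/sigT_openP => j.
rewrite (_ : _ @^-1` _ = W i j); first exact: overlap_open.
apply/seteqP; split => x /=; first by case=> y _ /in_glue_eq[-> ].
by move=> Wx; exists x => //; apply/in_glue_eq.
Qed.

Lemma chart_iso i : lriso (open_subspace (chart i)) X.
Proof.
pose f (c : open_subspace (chart i)) : X := glue_proj (sub_incl c).
have gP x : in_glue i x \in chart i by apply/mem_set; exists x.
pose g (x : X) : open_subspace (chart i) := SigSub (gP x).
have fC : continuous f.
  move=> c; apply: (@continuous_comp _ _ _ (@sub_incl _ (chart i)) glue_proj).
    exact: sub_incl_continuous.
  exact: glue_proj_continuous.
have gC : continuous g.
  by apply: continuous_comp_initial => x; exact: in_glue_continuous.
have fK : cancel f g.
  move=> [c ci]; apply/val_inj => /=; rewrite /f /sub_incl /=.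
  have fK' (c' : glue_point) : chart i c' -> in_glue i (glue_proj c') = c'.
    by case=> x _ <-; rewrite in_glueK.
  by apply: fK'; exact: set_mem ci.
have gK : cancel g f by move=> x; exact: in_glueK.
exists f, g, (fun c => [the {rmorphism _ -> _} of idfun]); split => //.
move=> t c; split=> [rt|[s [t' rt' st'] ts]].
  exists (fun z => t (glue_proj z)); last exact: (@nearW _ (nbhs c)).
  by exists t => //; exact: (@nearW glue (nbhs (sub_incl c))).
have tt' : \forall z \near c, t (f z) = t' (f z).
  have := sub_incl_continuous st'; move: ts; apply: filterS2 => z h1 h2; exact: etrans h1 h2.
apply: regular_near rt'.
have gfc : nbhs (g (f c)) (fun z => t (f z) = t' (f z)) by rewrite (fK c).
have : nbhs (f c) (fun x => t (f (g x)) = t' (f (g x))) by exact: gC gfc.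
by apply: filterS => x; rewrite (gK x) => ->.
Qed.

End Gluing.

Lemma glue_spec_is_scheme (k : comNzRingType) (A : comAlgType k)
  (I : choiceType) (W : copies_gluing I (spec A)) : is_scheme (glue W).
Proof.
move=> c; have [i [x ->]] := in_glue_surj c.
exists (chart i), A; split; [exact: chart_open|by exists x|exact: chart_iso].
Qed.

Section CellDecomposition.
Variables (k : comNzRingType) (X : scheme k).

(* U (i + 1) \ U i, with its reduced structure of closed subscheme of the     *)
(* open subscheme U (i + 1).                                                  *)
Definition stratum (U : nat -> set X) (i : nat) : lrspace k :=
  reduced_closed (X := open_subspace (U i.+1))
    [set x | ~ U i (sub_incl x)].

Definition is_cell_decomposition (t : nat) (U : nat -> set X) : Prop :=
  [/\ forall i, (i <= t)%N -> open (U i),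
      U 0 = set0, U t = setT,
      forall i, (i < t)%N -> U i `<=` U i.+1 &
      forall i, (i < t)%N -> exists d : nat, lriso (stratum U i) (affine_space k d)].

Definition has_cell_decomposition : Prop :=
  exists t U, is_cell_decomposition t U.

End CellDecomposition.

Definition components (T : topologicalType) (S : set T) : set (set T) :=
  [set connected_component S x | x in S].

Section Arrangement.
Variables (R : realType) (n : nat).
Local Notation E := 'rV[R]_n.

Definition hyperplane (a : E) (b : R) : set E :=
  [set x | \sum_i a 0 i * x 0 i = b].

Record arrangement := Arrangement {
  hyperplanes : set (set E);
  arrangement_finite : finite_set hyperplanes;
  arrangementP : forall H, hyperplanes H ->
    exists a b, a != 0 /\ H = hyperplane a b
}.

Definition linear_poly (a : E) (b : R) : {mpoly R[n]} :=
  \sum_i a 0 i *: 'X_i - b%:MP.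

(* The hyperplane H of R^n as a closed subset of the scheme A^n: the zero     *)
(* locus of its equations, which are scalar multiples of each other.          *)
Definition hyperplane_locus (H : set E) : set (affine_space R n) :=
  zeros [set l : {mpoly R[n]} |
    exists a b, [/\ a != 0, H = hyperplane a b & l = linear_poly a b]].

Variable A : arrangement.

Definition complement : set E := ~` \bigcup_(H in hyperplanes A) H.

Definition chamber : choiceType := set_type (components complement).

Definition Sep (C D : set E) : set (set E) :=
  [set H | hyperplanes A H /\ exists K L, [/\ components (~` H) K,
    components (~` H) L, C `<=` K, D `<=` L & K <> L]].

Lemma Sep_self (C : set E) : C !=set0 -> Sep C C = set0.
Proof.
move=> [c Cc]; rewrite -subset0 => H [_ [_ [_ [[x _ <-] [y _ <-] CK CL]]]].
apply; rewrite (same_connected_component (CK _ Cc)).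
by rewrite (same_connected_component (CL _ Cc)).
Qed.

Lemma SepC (C D : set E) : Sep C D = Sep D C.
Proof.
by apply/seteqP; split => H [AH [K [L [HK HL CK DL KL]]]]; split => //;
  exists L, K; split => //; exact: nesym.
Qed.

Lemma Sep_cocycle (C D F : set E) : components complement D ->
  Sep C F `<=` Sep C D `|` Sep D F.
Proof.
move=> [x cx <-] H [AH [K [L [HK HL CK FL KL]]]].
have sub : complement `<=` ~` H by move=> z cz Hz; apply: cz; exists H.
set M := connected_component (~` H) x.
have HM : components (~` H) M by exists x => //; exact: sub.
have DM : connected_component complement x `<=` M.
  apply: connected_component_max.
  - exact: connected_component_refl.
  - by apply: subset_trans sub; exact: connected_component_sub.
  - exact: component_connected.
have [KM|KM] := pselect (K = M).
  by right; split => //; exists M, L; split => //; rewrite -KM.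
by left; split => //; exists K, M.
Qed.

Definition chamber_overlap (C D : chamber) : set (affine_space R n) :=
  ~` \bigcup_(H in Sep (set_val C) (set_val D)) hyperplane_locus H.

Lemma chamber_overlap_open C D : open (chamber_overlap C D).
Proof.
rewrite openC; apply: closed_bigcup => [|H _].
  by apply: sub_finite_set (arrangement_finite A) => H [].
rewrite -openC; exists [set l : {mpoly R[n]} |
  exists a b, [/\ a != 0, H = hyperplane a b & l = linear_poly a b]].
by [].
Qed.

Lemma chamber_overlap_refl C : chamber_overlap C C = setT.
Proof.
rewrite /chamber_overlap Sep_self ?bigcup_set0 ?setC0//.
have [x cx] := set_mem (valP C); rewrite -[val C]/(set_val C) => <-.
by exists x; exact: connected_component_refl.
Qed.

Lemma chamber_overlap_sym C D : chamber_overlap C D = chamber_overlap D C.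
Proof. by rewrite /chamber_overlap SepC. Qed.

Lemma chamber_overlap_cocycle C D F :
  chamber_overlap C D `&` chamber_overlap D F `<=` chamber_overlap C F.
Proof.
move=> p [pCD pDF] [H SH Hp].
have [S|S] := Sep_cocycle (set_mem (valP D)) SH; first by apply: pCD; exists H.
by apply: pDF; exists H.
Qed.

Definition arrangement_gluing : copies_gluing chamber (affine_space R n) :=
  CopiesGluing chamber_overlap_open chamber_overlap_refl chamber_overlap_sym
    chamber_overlap_cocycle.

Definition arrangement_scheme : scheme R :=
  @Scheme R (glue arrangement_gluing)
    (@glue_spec_is_scheme _ _ _ arrangement_gluing).

End Arrangement.

(* Main.v *)
(* Fix a generic point u of R^n, let q_C be the point of the closure of the   *)
(* chamber C nearest to u, and add the charts X_C one by one in order of      *)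
(* increasing distance |q_C - u|.  What X_C adds is the set of the p in A^n   *)
(* such that every earlier D is separated from C by a hyperplane through p,   *)
(* and this is the flat F_C cut out by the hyperplanes through q_C:           *)
(* - if p is in F_C and no hyperplane through p separates C from D, then D is *)
(*   in the cone spanned by C at q_C, whose nearest point to u is also q_C,   *)
(*   so D is C or comes later;                                                *)
(* - if p is not in F_C, then by genericity q_C is not the point nearest to u *)
(*   of the region that contains C and is bounded by the hyperplanes through  *)
(*   p, so this region contains a chamber that comes before C.                *)
(* A flat is the zero locus of the kernel of a split surjection of polynomial *)
(* rings, hence, with its reduced structure, an affine space.                 *)

(* The two steps of this outline are [nearest_same_chamber] and [generic_closer]. Both rest on the
   first-order condition at a nearest point, [nearest_feasible_dir]; the second also needs u to be
   generic, and such a u is supplied by [exists_generic_point]. Ties in the distance may be broken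
   arbitrarily: a nearest point of a convex set is unique, so a chamber other than C on the same
   side as C of every hyperplane through q_C is strictly farther from u.

   [sweep_stratum] carries this over to A^n: a hyperplane passes through p when its equation lies in
   the prime p, so the same argument covers every point of the scheme.

   On the algebraic side, [flat_retraction] gives a flat a linear parametrization and a linear
   retraction, that is, a split surjection of polynomial rings. [glue_stratum_iso] deduces that the
   stratum is the spectrum of the target: this ring is a domain, so a function vanishing on the flat
   near one of its points restricts to zero on the whole flat. *)
From HB Require Import structures.
From mathcomp Require Import all_boot all_order all_algebra.
From mathcomp Require Import mpoly.
From mathcomp Require Import all_classical reals topology.
From mathcomp Require Import normedtype derive.
From mathcomp Require Import ring lra.
Require Import Defs.

Set Implicit Arguments.
Unset Strict Implicit.
Unset Printing Implicit Defensive.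

Import Order.TTheory GRing.Theory Num.Theory.
Import numFieldNormedType.Exports.

Local Open Scope quotient_scope.
Local Open Scope classical_set_scope.
Local Open Scope ring_scope.

(** * Closed subschemes defined by split surjections *)

Section Comap.
Variables (A B : comNzRingType) (psi : {rmorphism B -> A}) (p : prime_spectrum A).

Definition comap_mem : B -> bool := fun b => psi b \in p.

Lemma comap_ideal : idealr_closed comap_mem.
Proof.
split.
- by change (psi 0 \in p); rewrite rmorph0 prime0.
- by change (psi 1 \notin p); rewrite rmorph1 prime1.
- move=> a u v up vp; change (psi (a * u + v) \in p).
  by rewrite rmorphD rmorphM primeD // primeMl.
Qed.

Lemma comap_prime : prime_idealr_closed comap_mem.
Proof.
move=> u v uv; change ((psi u \in p) || (psi v \in p)).
by rewrite -primeM -rmorphM.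
Qed.

Definition comap : prime_spectrum B := PrimeIdeal comap_ideal comap_prime.

Lemma mem_comap b : (b \in comap) = (psi b \in p).
Proof. by []. Qed.

Lemma comap_denom b : b \notin comap -> psi b \notin p.
Proof. by []. Qed.

Definition loc_map (x : loc comap) : loc p :=
  frac (psi (loc_num x)) (comap_denom (loc_denP x)).

Lemma loc_mapE b g (gp : g \notin comap) (gp' : psi g \notin p) :
  loc_map (frac b gp) = frac (psi b) gp'.
Proof.
have /frac_eq[u up eu] := loc_fracE (frac b gp).
apply/frac_eq; exists (psi u) => //.
by rewrite -!rmorphM -!rmorphB -rmorphM -opprB mulrN eu oppr0 rmorph0.
Qed.

Lemma loc_map_is_zmod_morphism : zmod_morphism loc_map.
Proof.
move=> x y; have [a [f [fp ->]]] := frac_surj x.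
have [b [g [gp ->]]] := frac_surj y.
rewrite fracN fracD !(loc_mapE _ _ (comap_denom fp), loc_mapE _ _ (comap_denom gp)).
rewrite (loc_mapE _ _ (comap_denom (denomM fp gp))) fracN fracD.
by apply: frac_eq1; rewrite rmorphD !rmorphM !rmorphN.
Qed.

Lemma loc_map_is_monoid_morphism : monoid_morphism loc_map.
Proof.
split=> [|x y].
  rewrite [1 in LHS](_ : _ = loc_of _ 1) ?rmorph1// /loc_of.
  rewrite (loc_mapE _ _ (comap_denom (prime1 comap))).
  rewrite [RHS](_ : _ = loc_of _ 1) ?rmorph1// /loc_of.
  by apply: frac_eq1; rewrite rmorph1.
have [a [f [fp ->]]] := frac_surj x; have [b [g [gp ->]]] := frac_surj y.
rewrite fracM !(loc_mapE _ _ (comap_denom fp), loc_mapE _ _ (comap_denom gp)).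
rewrite (loc_mapE _ _ (comap_denom (denomM fp gp))) fracM.
by apply: frac_eq1; rewrite !rmorphM.
Qed.

HB.instance Definition _ := GRing.isZmodMorphism.Build _ _ loc_map
  loc_map_is_zmod_morphism.
HB.instance Definition _ := GRing.isMonoidMorphism.Build _ _ loc_map
  loc_map_is_monoid_morphism.

End Comap.

Lemma comap_continuous (A B : comNzRingType) (psi : {rmorphism B -> A}) :
  continuous (comap psi).
Proof.
apply/continuousP => _ [E ->]; exists (psi @` E).
apply/seteqP; split=> p /= h g; apply: h => a.
  by move=> Ea; rewrite mem_comap; apply: g; exists a.
by move=> [b Eb <-]; rewrite -mem_comap; exact: g.
Qed.

Section ZeroPrime.
Variable B : comNzRingType.
Hypothesis B_domain : forall a b : B, a * b = 0 -> a = 0 \/ b = 0.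

Lemma zero_ideal : idealr_closed (pred1 (0 : B)).
Proof.
split; rewrite ?inE ?eqxx ?oner_neq0// => a u v.
by rewrite !inE => /eqP-> /eqP->; rewrite mulr0 addr0.
Qed.

Lemma zero_prime : prime_idealr_closed (pred1 (0 : B)).
Proof.
move=> u v; rewrite !inE => /eqP/B_domain[->|->]; rewrite eqxx//.
by rewrite orbT.
Qed.

Definition generic_prime : prime_spectrum B := PrimeIdeal zero_ideal zero_prime.

Lemma near_generic_prime (p : prime_spectrum B) (U : set (prime_spectrum B)) :
  nbhs p U -> U generic_prime.
Proof.
rewrite nbhsE => -[_ [[E ->]] /= Ep] sub; apply: sub => /= h; apply: Ep => e Ee.
by have := h e Ee; rewrite inE => /eqP ->; exact: prime0.
Qed.

End ZeroPrime.

(* The closed subscheme of Spec A defined by the kernel of a split surjection *)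
(* phi : A -> B onto a domain is Spec B, and it is already reduced; here it   *)
(* is seen in a space with the sheaf pulled back from Spec A.                 *)
Section RetractIso.
Variables (k : comNzRingType) (A B : comAlgType k).
Variables (phi : {rmorphism A -> B}) (psi : {rmorphism B -> A}).
Hypothesis psi_alg : forall c : k, psi c%:A = c%:A.
Hypothesis phiK : cancel psi phi.
Hypothesis B_domain : forall a b : B, a * b = 0 -> a = 0 \/ b = 0.
(** Two successive inverse images, because a stratum sits in an open subspace of a glued space and
    both constructions are inverse images. *)
Variables (Y1 Y2 : topologicalType) (f1 : Y1 -> spec A) (f1C : continuous f1).
Variables (f2 : Y2 -> inv_image f1C) (f2C : continuous f2).
Let X := inv_image f2C.
Let proj (y : X) : spec A := f1 (f2 y).
Variable Z : set X.
Hypothesis ZP : forall y, Z y -> forall a, a - psi (phi a) \in proj y.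
Variable g : prime_spectrum B -> subspace_type Z.
Hypothesis gC : continuous g.
Hypothesis proj_g : forall q, proj (sub_incl (g q)) = comap phi q.
Hypothesis gK : forall z, g (comap psi (proj (sub_incl z))) = z.

Let f (z : subspace_type Z) : prime_spectrum B := comap psi (proj (sub_incl z)).

Let inZ (z : subspace_type Z) : Z (sub_incl z).
Proof. exact: (set_mem (valP (z : set_type Z))). Qed.

Let proj_continuous : continuous proj.
Proof.
by move=> y; apply: (@continuous_comp _ _ _ (f2 : Y2 -> Y1) f1);
  [exact: f2C|exact: f1C].
Qed.

Let fC : continuous f.
Proof.
move=> z; apply: (@continuous_comp _ _ _ (fun z => proj (sub_incl z)) (comap psi));
  last exact: comap_continuous.
apply: (@continuous_comp _ _ _ (@sub_incl _ Z) proj).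
  exact: sub_incl_continuous.
exact: proj_continuous.
Qed.

Let fK q : f (g q) = q.
Proof.
apply: prime_spectrumP; apply/funext => b.
change ((b \in f (g q)) = (b \in q)).
by rewrite /f mem_comap proj_g mem_comap phiK.
Qed.

Let regular_pullback (t : forall p : spec A, stalk p) (y : X) :
  regular t (proj y) -> regular (fun y : X => t (proj y) : stalk y) y.
Proof.
move=> rt; exists (fun y1 : inv_image f1C => t (f1 y1)).
  by exists t => //; exact: (@nearW _ (nbhs (f2 y : Y1))).
exact: (@nearW _ (nbhs (y : Y2))).
Qed.

Let regular_pullbackP (s : forall y : X, stalk y) (y : X) : regular s y ->
  exists2 t : forall p : spec A, stalk p,
    regular t (proj y) & \forall x \near y, s x = t (proj x).
Proof.
move=> [u [t rt ut] su]; exists t => //.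
have ut' : \forall x \near y, u (f2 x) = t (f1 (f2 x)) by exact: (f2C ut).
by apply: filterS2 su ut' => x -> ->.
Qed.

Let spec_regular_frac (a h : A) : exists t : forall p : spec A, stalk p,
  forall p (hp : h \notin (p : prime_spectrum A)), regular t p /\ t p = frac a hp.
Proof.
pose s (q : prime_spectrum A) : loc q :=
  if pselect (h \notin q) is left hq then frac a hq else 0.
have sE (q : prime_spectrum A) (hq : h \notin q) : s q = frac a hq.
  rewrite /s; case: pselect => // hq'.
  by rewrite (bool_irrelevance hq' hq).
exists s => p hp; split; last exact: sE.
by exists a, h; apply: filterS (near_basic hp) => q hq; exists hq; exact: sE.
Qed.

(* A fraction that vanishes along Z near z vanishes at the generic point.     *)
Let vanishing_frac (z : subspace_type Z) a h (hp : h \notin proj (sub_incl z)) :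
  vanishing (frac a hp : stalk (sub_incl z)) <-> phi a = 0.
Proof.
have [t tE] := spec_regular_frac a h.
have near_h : \forall y \near (sub_incl z : X), h \notin proj y.
  exact: (proj_continuous (near_basic hp)).
split=> [/asboolP[s [rs sz sZ]]|a0].
  have near_s : \forall y \near (sub_incl z : X), s y = t (proj y).
    have [rt te] := tE _ hp.
    apply: regular_germ_inj => //; first exact: regular_pullback.
    by rewrite sz te.
  have : \forall y \near (sub_incl z : X), Z y -> a \in proj y.
    apply: filterS3 near_s near_h sZ => y sy hy /[apply].
    have [_ ty] := tE _ hy; rewrite sy ty => nf.
    by apply/negPn/negP => /(frac_invertible a hy).
  (* Writing z as a value of [g] moves its neighbourhood to Spec B, where every nonempty open set
     contains the generic point. *)
  move=> /(@sub_incl_continuous X Z z); rewrite -{1}(gK z) => /gC.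
  move=> /(near_generic_prime B_domain) /(_ (inZ _)).
  by rewrite proj_g mem_comap inE => /eqP.
apply/asboolP; exists (fun y => t (proj y)).
have [rt te] := tE _ hp; split => //; first exact: regular_pullback.
apply: filterS near_h => y hy Zy; have [_ ->] := tE _ hy.
by move=> /frac_invertible/negP; apply; rewrite -[a]subr0 -(rmorph0 psi) -a0 ZP.
Qed.

Let mem_phi z (h : A) : (phi h \in f z) = (h \in proj (sub_incl z)).
Proof.
rewrite /f mem_comap; have /= hh := ZP (inZ z) h; apply/idP/idP => h'.
  by rewrite -[h](subrK (psi (phi h))) primeD.
by rewrite -[psi _](subKr h) primeD // primeN.
Qed.

Let theta z : {rmorphism loc (f z) -> red_stalk z} :=
  @red_class _ _ _ z \o @loc_map _ _ psi (proj (sub_incl z)).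

(** The numerator of the difference of a/h and psi(phi a)/psi(phi h) is killed by [phi], so the
    difference vanishes along [Z]. This makes [theta] surjective and lets a section a/h descend to
    phi a/phi h on Spec B. *)
Let theta_phi z a h (hp : h \notin proj (sub_incl z)) (hq : phi h \notin f z) :
  red_class (frac a hp : stalk (sub_incl z)) = theta z (frac (phi a) hq).
Proof.
rewrite /theta /= (loc_mapE _ _ (comap_denom hq)).
apply: (proj2 (@red_class_eq _ _ _ z _ _)).
have -> : (frac a hp : stalk (sub_incl z)) - frac (psi (phi a)) (comap_denom hq) =
   frac (a * psi (phi h) + - psi (phi a) * h) (denomM hp (comap_denom hq)).
  by rewrite -fracD -fracN.
by apply/vanishing_frac; rewrite rmorphD rmorphM rmorphM rmorphN !phiK; ring.
Qed.

Let theta_inj z : injective (theta z).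
Proof.
apply: raddf_inj => x; have [b [h [hp ->]]] := frac_surj x.
rewrite /theta /= (loc_mapE _ _ (comap_denom hp)) => e.
have : @red_class _ _ _ z (frac (psi b) (comap_denom hp)) = red_class 0.
  by rewrite e rmorph0.
move=> /(@red_class_eq _ _ _ z); rewrite subr0 => /vanishing_frac.
rewrite phiK => ->.
by rewrite -[RHS](rmorph0 (loc_of (f z))); apply: frac_eq1; rewrite !mul0r.
Qed.

Let theta_surj z (q : red_stalk z) : exists x, theta z x = q.
Proof.
have [a ->] := red_class_surj q; have [b [h [hp ->]]] := frac_surj a.
have hq : phi h \notin f z by rewrite mem_phi.
by exists (frac (phi b) hq); rewrite -(theta_phi _ hp).
Qed.

Let theta_bij z : bijective (theta z).
Proof.
have [h hK] := choice (@theta_surj z).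
by exists h => // x; apply: theta_inj; rewrite hK.
Qed.

(** The map [f] induced by [psi] has inverse [g]. A section b/h of Spec B corresponds to psi b/psi h
    along [Z], and a section a/h along [Z] to phi a/phi h. *)
Lemma retract_iso : lriso (reduced_closed Z) (spec B).
Proof.
exists f, g, theta; split => //.
- move=> z c; rewrite /theta /=.
  rewrite (loc_mapE _ _ (comap_denom (prime1 (f z)))); congr (@red_class _ _ _ z _).
  by apply: frac_eq1; rewrite psi_alg rmorph1.
- move=> t z; split=> [[b [h th]]|[s /regular_pullbackP[t' [a [h th]] st] ts]].
    have /= [hz _] := nbhs_singleton th.
    have [u uE] := spec_regular_frac (psi b) (psi h).
    have [ru _] := uE _ (comap_denom hz).
    exists (fun y : X => u (proj y) : stalk y).
      exact: (@regular_pullback u (sub_incl z) ru).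
    have thf := fC th; apply: (@filterS _ (nbhs z) _ _ _ _ thf) => y /= [hy ->].
    have [_ ->] := uE _ (comap_denom hy).
    by rewrite (loc_mapE _ _ (comap_denom hy)).
  exists (phi a), (phi h).
  have st' := @sub_incl_continuous X Z z _ st.
  have th' : \forall y \near z, exists fq : h \notin proj (sub_incl y),
      t' (proj (sub_incl y)) = frac a fq.
    exact: (@sub_incl_continuous X Z z _ (proj_continuous th)).
  pose isfrac (q : prime_spectrum B) :=
    exists hq : phi h \notin q, t q = frac (phi a) hq.
  have : \forall y \near z, isfrac (f y).
    apply: filterS3 ts st' th' => y tsy sty [hp thy].
    have hq : phi h \notin f y by rewrite mem_phi.
    exists hq; apply: theta_inj; rewrite -(theta_phi _ hp) tsy.
    by congr red_class; rewrite -thy; exact: sty.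
  rewrite -{1}(gK z) => /gC.
  apply: (@filterS _ (nbhs (f z : prime_spectrum B))) => q.
  by change (isfrac (f (g q)) -> isfrac q); rewrite fK.
Qed.

End RetractIso.

Section GlueStratum.
Variables (k : comNzRingType) (A B : comAlgType k).
Variables (phi : {rmorphism A -> B}) (psi : {rmorphism B -> A}).
Hypothesis psi_alg : forall c : k, psi c%:A = c%:A.
Hypothesis phiK : cancel psi phi.
Hypothesis B_domain : forall a b : B, a * b = 0 -> a = 0 \/ b = 0.
Variables (I : choiceType) (W : copies_gluing I (spec A)) (i : I).
Variables (U V : set (glue W)).
Hypothesis UV : V = U `|` chart i.
Hypothesis UP : forall p : spec A,
  ~ U (in_glue W i p) <-> forall a, a - psi (phi a) \in (p : prime_spectrum A).

Let Z : set (open_subspace V) := [set x | ~ U (sub_incl x)].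

Let comapK (p : prime_spectrum A) :
  (forall a, a - psi (phi a) \in p) -> comap phi (comap psi p) = p.
Proof.
move=> h; apply: prime_spectrumP; apply/funext => a.
change ((a \in comap phi (comap psi p)) = (a \in p)).
rewrite !mem_comap; apply/idP/idP => ap.
  by rewrite -[a](subrK (psi (phi a))) primeD // h.
by rewrite -[psi _](subKr a) primeD // primeN // h.
Qed.

Let inV (q : prime_spectrum B) : in_glue W i (comap phi q) \in V.
Proof. by apply/mem_set; rewrite UV; right; exists (comap phi q). Qed.

Let g1 (q : prime_spectrum B) : open_subspace V := SigSub (inV q).

Let inZ q : g1 q \in Z.
Proof.
apply/mem_set; apply/UP => a.
by rewrite mem_comap rmorphB phiK subrr prime0.
Qed.

Let g (q : prime_spectrum B) : subspace_type Z := SigSub (inZ q).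

(** The points of [V] outside [U] all lie in the chart [i], where they form the zero locus of the
    kernel of [phi]. On this locus the map induced by [phi], followed by the chart, inverts the one
    induced by [psi]. *)
Lemma glue_stratum_iso : lriso (reduced_closed Z) (spec B).
Proof.
have ZE (y : open_subspace V) : Z y ->
    exists2 p : spec A, sub_incl y = in_glue W i p &
      forall a, a - psi (phi a) \in (p : prime_spectrum A).
  move=> nU; have : (U `|` chart i) (sub_incl y).
    by rewrite -UV; exact: (set_mem (valP (y : set_type V))).
  move=> -[//|].
  move=> [p _ e]; exists p => //; apply/UP; rewrite e; exact: nU.
apply: (@retract_iso _ _ _ _ _ psi_alg phiK B_domain _ _ _ _ _ _ Z _ g).
- move=> y /ZE[p e h] a; rewrite e in_glueK; exact: h.
- apply: continuous_comp_initial; apply: continuous_comp_initial => q.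
  apply: (@continuous_comp _ _ _ (comap phi) (in_glue W i)).
    exact: comap_continuous.
  exact: in_glue_continuous.
- by move=> q; rewrite /= in_glueK.
- move=> z; apply/val_inj/val_inj => /=.
  have [p e h] := ZE _ (set_mem (valP (z : set_type Z))).
  change (in_glue W i (comap phi (comap psi (glue_proj (sub_incl (sub_incl z))))) =
    sub_incl (sub_incl z)).
  by rewrite e in_glueK comapK.
Qed.

End GlueStratum.

(** * Affine flats *)

Section FlatRetraction.
Variables (R : realType) (m n : nat) (M : 'M[R]_(m, n)) (q : 'rV[R]_n).

Let d : nat := \rank (kermx M^T).
Let V : 'M[R]_(d, n) := row_base (kermx M^T).
Let w : 'M[R]_(n, d) := pinvmx V.

Let Vw : V *m w = 1%:M.
Proof. by rewrite /w mulmxVp // row_base_free. Qed.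

Let VM : V *m M^T = 0.
Proof. by apply/sub_kermxP; rewrite /V eq_row_base. Qed.

(** The columns of 1 - w V are orthogonal to the rows of [V], hence to the whole direction space of
    the flat, so they lie in the row space of [M]. *)
Let ex_D : exists D : 'M[R]_(n, m), (1%:M - w *m V)^T = D *m M.
Proof.
apply/submxP; rewrite submxE.
have /submxP[E VE] : ((cokermx M)^T <= V)%MS.
  by rewrite /V eq_row_base; apply/sub_kermxP; rewrite -trmx_mul mulmx_coker trmx0.
apply/eqP/trmx_inj; rewrite trmx_mul trmxK trmx0 VE mulmxBr mulmx1.
by rewrite -mulmxA (mulmxA V w) Vw mul1mx subrr.
Qed.

(** The rows of [V] are a basis of the direction space of the flat. [phi] is the pullback along its
    parametrization y |-> q + y V, and [psi] the pullback along x |-> (x - q) w, which recovers y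
    because V w = 1. *)
Let phi : {mpoly R[n]} -> {mpoly R[d]} :=
  comp_mpoly [tuple (q 0 i)%:MP + \sum_j V j i *: 'X_j | i < n].
Let psi : {mpoly R[d]} -> {mpoly R[n]} :=
  comp_mpoly [tuple \sum_i w i j *: ('X_i - (q 0 i)%:MP) | j < d].

Let phiX i : phi 'X_i = (q 0 i)%:MP + \sum_j V j i *: 'X_j.
Proof. by rewrite /phi comp_mpolyXU nth_mktuple. Qed.

Let psiX j : psi 'X_j = \sum_i w i j *: ('X_i - (q 0 i)%:MP).
Proof. by rewrite /psi comp_mpolyXU nth_mktuple. Qed.

Let phiC c : phi c%:MP = c%:MP.
Proof. exact: comp_mpolyC. Qed.

Let psiC c : psi c%:MP = c%:MP.
Proof. exact: comp_mpolyC. Qed.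

Let phiZ c P : phi (c *: P) = c *: phi P.
Proof. exact: linearZ. Qed.

Let psiZ c P : psi (c *: P) = c *: psi P.
Proof. exact: linearZ. Qed.

Let phi_sum I (r : seq I) (F : I -> {mpoly R[n]}) :
  phi (\sum_(i <- r) F i) = \sum_(i <- r) phi (F i).
Proof. exact: raddf_sum. Qed.

Let psi_sum I (r : seq I) (F : I -> {mpoly R[d]}) :
  psi (\sum_(i <- r) F i) = \sum_(i <- r) psi (F i).
Proof. exact: raddf_sum. Qed.

Let phiXq i : phi ('X_i - (q 0 i)%:MP) = \sum_j V j i *: 'X_j.
Proof.
rewrite (_ : phi _ = phi 'X_i - phi (q 0 i)%:MP); last exact: rmorphB.
by rewrite phiX phiC addrC addKr.
Qed.

(** Congruence modulo [p] passes to sums and products. It serves twice: at the zero prime it gives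
    an equality, in [phiK], and at a point of the flat it reduces a claim about all polynomials to
    the variables. *)
Let mpoly_morph_ind (r : nat) (S : comNzRingType) (f g : {rmorphism {mpoly R[r]} -> S})
    (p : prime_spectrum S) :
  (forall c, f c%:MP = g c%:MP) -> (forall i, f 'X_i - g 'X_i \in p) ->
  forall P, f P - g P \in p.
Proof.
move=> fgC fgX.
have fgM P Q : f P - g P \in p -> f Q - g Q \in p -> f (P * Q) - g (P * Q) \in p.
  move=> hP hQ; rewrite !rmorphM.
  have -> : f P * f Q - g P * g Q = f P * (f Q - g Q) + g Q * (f P - g P) by ring.
  by rewrite primeD // primeMl.
have fgMon mo : f 'X_[mo] - g 'X_[mo] \in p.
  rewrite mpolyXE_id; apply: (big_ind (fun P => f P - g P \in p)).
  - by rewrite !rmorph1 subrr prime0.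
  - exact: fgM.
  - move=> i _; elim: (mo i) => [|e IH]; first by rewrite expr0 !rmorph1 subrr prime0.
    by rewrite exprS; apply: fgM.
elim/mpolyind => [|c mo P _ _ IH]; first by rewrite !rmorph0 subrr prime0.
rewrite !rmorphD opprD addrACA primeD // -mul_mpolyC.
by apply: fgM => //; rewrite fgC subrr prime0.
Qed.

Let phiK : cancel psi phi.
Proof.
move=> P.
have C c : phi (psi c%:MP) = c%:MP by rewrite psiC phiC.
have X j : phi (psi 'X_j) = 'X_j.
  rewrite psiX phi_sum.
  under eq_bigr => i _ do rewrite phiZ phiXq scaler_sumr.
  rewrite exchange_big /=.
  under eq_bigr => l _.
    under eq_bigr => i _ do rewrite scalerA mulrC.
    rewrite -scaler_suml (_ : \sum_(i < n) _ = (V *m w) l j); last by rewrite mxE.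
    rewrite Vw mxE; over.
  rewrite (bigD1 j) //= eqxx scale1r big1 ?addr0// => l /negPf ->.
  by rewrite scale0r.
have dom (a b : {mpoly R[d]}) : a * b = 0 -> a = 0 \/ b = 0.
  by move/eqP; rewrite mulf_eq0 => /orP[] /eqP; [left|right].
have := @mpoly_morph_ind d _ (phi \o psi) idfun (generic_prime dom) C.
move=> /(_ _ P) h; apply/eqP; rewrite -subr_eq0; apply: h => j /=.
change (phi (psi 'X_j) - 'X_j \in generic_prime dom).
by rewrite X subrr prime0.
Qed.

(** In one direction, [ex_D] writes X_i - psi(phi X_i) as a combination of the equations. In the
    other, [phi] kills every equation because V M^T = 0. *)
Lemma flat_retraction : exists (e : nat)
    (f : {rmorphism {mpoly R[n]} -> {mpoly R[e]}})
    (g : {rmorphism {mpoly R[e]} -> {mpoly R[n]}}),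
  [/\ forall c : R, g c%:A = c%:A, cancel g f &
    forall p : prime_spectrum {mpoly R[n]},
      (forall r, linear_poly (row r M) ((q *m M^T) 0 r) \in p) <->
      forall P, P - g (f P) \in p].
Proof.
exists d, phi, psi; split => //.
  by move=> c; rewrite -!mul_mpolyC !mulr1; exact: psiC.
have linE r : linear_poly (row r M) ((q *m M^T) 0 r) =
    \sum_i M r i *: ('X_i - (q 0 i)%:MP).
  rewrite /linear_poly mxE raddf_sum -sumrB; apply: eq_bigr => i _.
  by rewrite !mxE scalerBr /= mulrC mpolyCM mul_mpolyC.
move=> p; split=> [h P|h r].
  have := @mpoly_morph_ind n _ idfun (psi \o phi) p.
  apply => [c|i]; first by change (c%:MP = psi (phi c%:MP)); rewrite phiC psiC.
  change ('X_i - psi (phi 'X_i) \in p).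
  have [D DE] := ex_D.
  rewrite (_ : _ - _ = \sum_r D i r *: linear_poly (row r M) ((q *m M^T) 0 r)).
    elim/big_ind: _ => [|x y|r _]; [exact: prime0|exact: primeD|].
    by rewrite -mul_mpolyC primeMl.
  have -> : 'X_i - psi (phi 'X_i) =
      \sum_l (1%:M - w *m V)^T i l *: ('X_l - (q 0 l)%:MP).
    rewrite phiX (_ : psi _ = (q 0 i)%:MP + psi (\sum_j V j i *: 'X_j)); last first.
      by rewrite -[in RHS]psiC; exact: rmorphD.
    rewrite opprD addrA.
    under [RHS]eq_bigr => l _ do rewrite !mxE scalerBl.
    rewrite sumrB; congr (_ - _).
      rewrite (bigD1 i) //= eqxx scale1r big1 ?addr0// => l /negPf ->.
      by rewrite scale0r.
    rewrite psi_sum.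
    under eq_bigr => j _ do rewrite psiZ psiX scaler_sumr.
    rewrite exchange_big /=; apply: eq_bigr => l _.
    rewrite scaler_suml; apply: eq_bigr => j _.
    by rewrite scalerA mulrC.
  rewrite DE; under eq_bigr => l _ do rewrite mxE scaler_suml.
  rewrite exchange_big /=; apply: eq_bigr => r _.
  by rewrite linE scaler_sumr; apply: eq_bigr => l _; rewrite scalerA.
set l := linear_poly _ _; suff phil : phi l = 0.
  have : l - psi (phi l) \in p by exact: h.
  by rewrite phil (_ : psi 0 = 0) ?subr0//; exact: rmorph0.
rewrite /l.
rewrite linE phi_sum.
under eq_bigr => i _ do rewrite phiZ phiXq scaler_sumr.
rewrite exchange_big /= big1 // => j _.
under eq_bigr => i _ do rewrite scalerA.
rewrite -scaler_suml (_ : \sum_(i < n) _ = (V *m M^T) j r); last first.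
  by rewrite mxE; apply: eq_bigr => i _; rewrite [M^T _ _]mxE mulrC.
by rewrite VM mxE scale0r.
Qed.

End FlatRetraction.

(** * Euclidean geometry of hyperplane arrangements *)

Section Dot.
Variables (R : realType) (n : nat).
Implicit Types (u v x y : 'rV[R]_n) (c : R).

Definition dot u v : R := \sum_i u 0 i * v 0 i.

Lemma dotE u v : dot u v = (u *m v^T) 0 0.
Proof. by rewrite mxE; apply: eq_bigr => i _; rewrite mxE. Qed.

Lemma dotC u v : dot u v = dot v u.
Proof. by apply: eq_bigr => i _; rewrite mulrC. Qed.

Lemma dotDr u v x : dot u (v + x) = dot u v + dot u x.
Proof. by rewrite !dotE raddfD /= mulmxDr mxE. Qed.

Lemma dotNr u v : dot u (- v) = - dot u v.
Proof. by rewrite !dotE raddfN /= mulmxN mxE. Qed.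

Lemma dotZr c u v : dot u (c *: v) = c * dot u v.
Proof. by rewrite !dotE linearZ /= -scalemxAr mxE. Qed.

Lemma dotDl u v x : dot (v + x) u = dot v u + dot x u.
Proof. by rewrite dotC dotDr !(dotC u). Qed.

Lemma dotNl u v : dot (- v) u = - dot v u.
Proof. by rewrite dotC dotNr (dotC u). Qed.

Lemma dotZl c u v : dot (c *: v) u = c * dot v u.
Proof. by rewrite dotC dotZr (dotC u). Qed.

Lemma dot_ge0 u : 0 <= dot u u.
Proof. by apply: sumr_ge0 => i _; rewrite -expr2 sqr_ge0. Qed.

Lemma dot_eq0 u : dot u u = 0 -> u = 0.
Proof.
move=> /eqP; rewrite psumr_eq0 => [/allP u0|i _]; last by rewrite -expr2 sqr_ge0.
apply/rowP => i; have := u0 i; rewrite mem_index_enum => /(_ isT).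
by rewrite mulf_eq0 orbb mxE => /eqP.
Qed.

Lemma dot_continuous u : continuous (dot u).
Proof.
apply: (@continuous_big R _ +%R 0 xpredT); first exact: add_continuous.
move=> i _ x; have cX := @coord_continuous R 1 n 0 i.
exact: (continuousM (@cst_continuous _ _ (u 0 i) x) (cX x)).
Qed.

Lemma sqr_dist_continuous u : continuous (fun x => dot (x - u) (x - u)).
Proof.
apply: (@continuous_big R _ +%R 0 xpredT); first exact: add_continuous.
move=> i _ x.
have cX : {for x, continuous (fun y : 'rV[R]_n => (y - u) 0 i)}.
  rewrite (_ : (fun y => _) = (fun y : 'rV[R]_n => y 0 i - u 0 i)).
    have cX := @coord_continuous R 1 n 0 i.
    exact: (continuousB (cX x) (@cst_continuous _ _ (u 0 i) x)).
  by apply/funext => y; rewrite !mxE.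
exact: (continuousM cX cX).
Qed.

Lemma sqr_dist_line x v y c : dot (x + c *: v - y) (x + c *: v - y) =
  dot (x - y) (x - y) + c * (2 * dot (x - y) v + c * dot v v).
Proof.
rewrite (_ : x + c *: v - y = (x - y) + c *: v); last by rewrite addrAC.
by move: (x - y) => z; rewrite !dotDl !dotDr !dotZl !dotZr (dotC v z); ring.
Qed.

(* |x|^2 <= 2 |x - u|^2 + 2 |u|^2, so that a Euclidean ball is bounded for    *)
(* the sup norm.                                                              *)
Lemma compact_ball u (r : R) (F : set 'rV[R]_n) : closed F ->
  compact (F `&` [set x | dot (x - u) (x - u) <= r]).
Proof.
move=> Fcl; apply: bounded_closed_compact; last first.
  apply: closedI => //.
  have /continuous_closedP h := @sqr_dist_continuous u.
  exact: (h _ (@closed_le _ r)).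
pose K := 2 * r + 2 * dot u u + 1.
exists K; split; first exact: num_real.
move=> M KM x [_ xr] /=; have sq i : x 0 i ^+ 2 <= 2 * r + 2 * dot u u.
  apply: (@le_trans _ _ (dot x x)).
    rewrite /dot (bigD1 i) //= expr2 lerDl.
    by apply: sumr_ge0 => j _; rewrite -expr2 sqr_ge0.
  have xE := esym (subrK u x); move: xr xE => /=; move: (x - u) => z zr ->.
  by have := dot_ge0 (z - u); rewrite !(dotDl, dotDr, dotNl, dotNr) (dotC u z); lra.
have M1 : 1 <= M.
  have := dot_ge0 u; have := dot_ge0 (x - u).
  by rewrite /K in KM; move: xr => /=; lra.
rewrite [leLHS]/Num.norm /= mx_normrE.
apply: bigmax_le => [|[j i] _ /=]; first lra.
rewrite ord1 -ler_sqr ?nnegrE ?normr_ge0 ?real_normK ?num_real//; last lra.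
by rewrite /K in KM; have := sq i; nra.
Qed.

(** The points of [F] farther away than a chosen one can be ignored, and the others form a compact
    set. *)
Lemma exists_nearest u (F : set 'rV[R]_n) : closed F -> F !=set0 ->
  exists2 q, F q & forall y, F y -> dot (q - u) (q - u) <= dot (y - u) (y - u).
Proof.
move=> Fcl [z Fz]; pose r := dot (z - u) (z - u).
have [|q] := EVT_min_rV _ (@compact_ball u r F Fcl)
    (continuous_subspaceT (@sqr_dist_continuous u)).
  by exists z; split => //=.
rewrite inE => -[Fq qr] qmin; exists q => // y Fy.
have [yr|ry] := leP (dot (y - u) (y - u)) r; first by apply: qmin; rewrite inE.
exact: le_trans qr (ltW ry).
Qed.

End Dot.

Lemma near_right_gt0 (R : realType) (a b : R) :
  0 < a -> \forall e \near 0^'+, 0 < a + e * b.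
Proof.
move=> a0; have b0 : 0 < `|b| + 1 by rewrite ltr_wpDl.
have : 0 < a / (`|b| + 1) by rewrite divr_gt0.
move=> /nbhs_right_lt; apply: filterS2 (nbhs_right_gt 0) => e e0.
rewrite ltr_pdivlMr// => h.
have : e * - b <= e * `|b| by rewrite ler_pM2l// -normrN ler_norm.
lra.
Qed.

Lemma mul_gt0_trans (R : realType) (x y z : R) :
  0 < x * y -> 0 < x * z -> 0 < y * z.
Proof.
move=> xy xz; have x0 : x != 0 by apply: contraTneq xy => ->; rewrite mul0r ltxx.
have : 0 < (x * x) * (y * z) by rewrite mulrACA mulr_gt0.
by rewrite pmulr_rgt0// -expr2 exprn_even_gt0.
Qed.

Section Components.
Variables (R : realType) (n : nat) (I : Type).
Variables (a : I -> 'rV[R]_n) (b : I -> R).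

Definition affine_form i (x : 'rV[R]_n) : R := dot (a i) x - b i.
Local Notation h := affine_form.

Lemma affine_form_line i x v c : h i (x + c *: v) = h i x + c * dot (a i) v.
Proof. by rewrite /h dotDr dotZr addrAC. Qed.

Lemma affine_form_sub i x y : dot (a i) (x - y) = h i x - h i y.
Proof. by rewrite /h dotDr dotNr opprB addrA subrK. Qed.

Lemma affine_form_continuous i : continuous (h i).
Proof.
move=> x.
exact: (continuousB (@dot_continuous _ _ (a i) x) (@cst_continuous _ _ (b i) x)).
Qed.

Lemma line_continuous (x v : 'rV[R]_n) : continuous (fun c : R => x + c *: v).
Proof.
move=> c; apply: cvgD; first exact: cvg_cst.
exact: scalel_continuous.
Qed.

(** A form without zeros on a connected set keeps its sign there; conversely, the segment between
    two points with the same signs avoids all the hyperplanes. *)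
Lemma connected_component_signs x : (forall i, h i x != 0) ->
  connected_component [set y | forall i, h i y != 0] x =
  [set y | forall i, 0 < h i x * h i y].
Proof.
move=> x0; apply/seteqP; split=> [y Cy i|y xy].
  set C := connected_component _ _ in Cy.
  have Cx : C x by exact: connected_component_refl.
  have nz z : C z -> h i z != 0 by move/connected_component_sub; exact.
  have hC : is_interval (h i @` C).
    apply/connected_intervalP/connected_continuous_connected.
      exact: component_connected.
    exact/continuous_subspaceT/affine_form_continuous.
  have no0 : ~ (h i @` C) 0 by case=> z /nz/eqP.
  have hx := hC _ _ (imageP (h i) Cx) (imageP (h i) Cy) 0.
  have hy := hC _ _ (imageP (h i) Cy) (imageP (h i) Cx) 0.
  have [xi|xi|xi] := ltgtP (h i x) 0; last by move: (x0 i); rewrite xi eqxx.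
    rewrite nmulr_rgt0// ltNge; apply/negP => yi.
    by apply/no0/hx; rewrite ltW.
  rewrite pmulr_rgt0// ltNge; apply/negP => yi.
  by apply/no0/hy; rewrite yi ltW.
have seg c : `[0, 1]%classic c -> forall i, 0 < h i x * h i (x + c *: (y - x)).
  rewrite /= in_itv /= => /andP[c0 c1] i.
  rewrite affine_form_line affine_form_sub.
  have xx : 0 < h i x * h i x by rewrite -expr2 exprn_even_gt0//=.
  rewrite (_ : _ * _ = (1 - c) * (h i x * h i x) + c * (h i x * h i y)); last ring.
  move: c1; rewrite le_eqVlt => /orP[/eqP->|c1].
    by rewrite subrr mul0r add0r mul1r; exact: xy.
  by rewrite (ltr_wpDr (mulr_ge0 c0 (ltW (xy i))))// mulr_gt0 ?subr_gt0.
exists ((fun c : R => x + c *: (y - x)) @` `[0, 1]).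
  split.
  - by exists 0; [rewrite /= in_itv /= lexx ler01|rewrite scale0r addr0].
  - by move=> _ [c /seg + <-] i => /(_ i); apply: contraTneq => ->;
      rewrite mulr0 ltxx.
  - apply: connected_continuous_connected; first exact: segment_connected.
    exact/continuous_subspaceT/line_continuous.
by exists 1; [rewrite /= in_itv /= lexx ler01|rewrite scale1r subrKC].
Qed.

End Components.

Section Nearest.
Variables (R : realType) (n m : nat).
Variables (a : 'I_m -> 'rV[R]_n) (b : 'I_m -> R).
Local Notation h := (affine_form a b).

(** For x off the hyperplanes, this is the closure of the region around x bounded by the hyperplanes
    in [J]; with [xpredT] it is the closure of a chamber. *)
Definition closed_chamber (J : pred 'I_m) (x : 'rV[R]_n) : set 'rV[R]_n :=
  [set y | forall i, J i -> 0 <= h i x * h i y].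

Lemma closed_chamber_closed J x : closed (closed_chamber J x).
Proof.
rewrite (_ : closed_chamber J x = \bigcap_(i in [set i | J i])
    (h i @^-1` [set t | 0 <= h i x * t])).
  apply: closed_bigI => i _.
  have /continuous_closedP := @affine_form_continuous _ _ _ a b i; apply.
  have /continuous_closedP hc : continuous (fun t : R => h i x * t).
    by move=> t; apply: cvgM; [exact: cvg_cst|exact: cvg_id].
  exact: (hc _ (@closed_ge _ 0)).
by apply/seteqP; split=> y hy i Ji; exact: hy.
Qed.

(** A small step from q along v stays in the region: the constraints that are tight at q allow v,
    and the others are strict at q. Hence the distance to u cannot decrease to first order. *)
Lemma nearest_feasible_dir (J : pred 'I_m) x q u v :
  (forall i, h i x != 0) -> closed_chamber J x q ->
  (forall y, closed_chamber J x y -> dot (q - u) (q - u) <= dot (y - u) (y - u)) ->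
  (forall i, J i -> h i q = 0 -> 0 <= h i x * dot (a i) v) ->
  0 <= dot (q - u) v.
Proof.
move=> x0 Pq qmin dir.
have feas : \forall e \near 0^'+, closed_chamber J x (q + e *: v).
  apply: filter_forall => i.
  have [Ji|nJi] := boolP (J i); last exact: (@nearW _ (0^'+)).
  have [qi|qi] := eqVneq (h i q) 0.
    near=> e => _; have e0 : 0 < e by near: e; exact: nbhs_right_gt.
    by rewrite affine_form_line qi add0r mulrCA mulr_ge0 ?(ltW e0)// dir.
  have xq : 0 < h i x * h i q by rewrite lt_def mulf_neq0//= Pq.
  apply: filterS (near_right_gt0 (h i x * dot (a i) v) xq) => e he _.
  by rewrite affine_form_line mulrDr mulrCA ltW.
rewrite leNgt; apply/negP => neg.
have : \forall e \near 0^'+, 0 < - (2 * dot (q - u) v) + e * - dot v v.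
  by apply: near_right_gt0; lra.
move=> near1.
have [e [[e0 Pe] he]] :=
  filter_ex (filterI (filterI (nbhs_right_gt 0) feas) near1).
have := qmin _ Pe; rewrite sqr_dist_line.
have : 0 < e by [].
nra.
Unshelve. all: by end_near. Qed.

End Nearest.

Lemma exists_nonroot (R : numDomainType) (p : {poly R}) :
  p != 0 -> exists c, p.[c] != 0.
Proof.
move=> p0; apply: contrapT => /forallNP h.
pose rs := [seq k%:R : R | k <- iota 0 (size p)].
suff : (size rs < size p)%N by rewrite size_map size_iota ltnn.
apply: max_poly_roots => //; first by apply/allP => c _; apply/negPn/negP => /h.
by rewrite map_inj_uniq ?iota_uniq//; exact: mulrIn (oner_neq0 _).
Qed.

Lemma avoid_hyperplanes (R : realType) (n : nat) (I : finType)
    (w : I -> 'rV[R]_n) (e : I -> R) : (forall i, w i != 0) ->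
  exists x, forall i, dot (w i) x != e i.
Proof.
(* Points of the moment curve c |-> (c, c^2, ..., c^n) suffice.              *)
move=> w0; pose p i : {poly R} := \sum_j w i 0 j *: 'X^(j.+1) - (e i)%:P.
have p0 : \prod_i p i != 0.
  rewrite prodf_seq_neq0; apply/allP => i _ /=.
  have /rV0Pn[j wj] := w0 i; apply: contra wj => /eqP pi.
  have := congr1 (fun r : {poly R} => r`_j.+1) pi.
  rewrite coef0 coefB coefC subr0 coef_sum (bigD1 j) //= coefZ coefXn eqxx mulr1.
  rewrite big1 ?addr0 => [->//|l lj].
  by rewrite coefZ coefXn eqSS (_ : (_ == _) = false) ?mulr0// eq_sym; apply/negbTE.
have [c] := exists_nonroot p0; rewrite horner_prod prodf_seq_neq0 => /allP pc.
exists (\row_j c ^+ j.+1) => i; have := pc i; rewrite mem_index_enum => /(_ isT) /=.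
rewrite hornerD hornerN hornerC subr_eq0 horner_sum; apply: contra => /eqP <-.
by apply/eqP; apply: eq_bigr => j _; rewrite hornerZ hornerXn mxE.
Qed.

Lemma dot_row (R : realType) (k n : nat) (M : 'M[R]_(k, n)) i (q : 'rV[R]_n) :
  dot (row i M) q = (M *m q^T) i 0.
Proof. by rewrite mxE; apply: eq_bigr => j _; rewrite !mxE. Qed.

Section Generic.
Variables (R : realType) (n m : nat).
Variables (a : 'I_m -> 'rV[R]_n) (b : 'I_m -> R).
Local Notation h := (affine_form a b).

(** Rows outside [S] are zeroed rather than deleted, so that the matrices of all [S] have the same
    shape and rows keep their indices. *)
Definition span_mx (S : {set 'I_m}) : 'M[R]_(m, n) :=
  \matrix_(i < m) (if i \in S then a i else 0).

Lemma row_span_mx S i : row i (span_mx S) = if i \in S then a i else 0.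
Proof. by rewrite rowK. Qed.

(* When q is the orthogonal projection of u on the flat cut out by S, the     *)
(* hyperplanes through q contain this flat.                                   *)
Definition generic_point (u : 'rV[R]_n) := forall (S : {set 'I_m}) i q,
  (forall j, j \in S -> h j q = 0) -> h i q = 0 ->
  (u - q <= span_mx S)%MS -> (a i <= span_mx S)%MS.

(** The normal equations c M M^T = v M^T are solvable: if K is the cokernel of M M^T, then N = M^T K
    satisfies N^T N = 0, so N = 0 over the reals. *)
Lemma orthogonal_part (k : nat) (M : 'M[R]_(k, n)) (v : 'rV[R]_n) :
  exists c : 'rV[R]_k, (v - c *m M) *m M^T = 0.
Proof.
suff /submxP[c e] : (v *m M^T <= M *m M^T)%MS.
  by exists c; rewrite mulmxBl -mulmxA -e subrr.
rewrite submxE; set K := cokermx _.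
have MK : M *m M^T *m K = 0 by exact: mulmx_coker.
suff -> : v *m M^T *m K = 0 by [].
rewrite -mulmxA; suff -> : M^T *m K = 0 by rewrite mulmx0.
set N := M^T *m K; have NN : N^T *m N = 0.
  by rewrite trmx_mul trmxK -mulmxA (mulmxA M) MK mulmx0.
apply/matrixP => i j; rewrite [RHS]mxE.
suff /dot_eq0/rowP/(_ i) : dot (col j N)^T (col j N)^T = 0 by rewrite !mxE.
transitivity ((N^T *m N) j j); last by rewrite NN mxE.
by rewrite [RHS]mxE; apply: eq_bigr => l _; rewrite !mxE.
Qed.

(** When a_i is not in the span of [S], its part w orthogonal to this span is nonzero. A failure of
    genericity at (S, i) makes u - q orthogonal to w, so w.u = w.q, a value that depends only on [S]
    and i. It remains to avoid finitely many hyperplanes. *)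
Lemma exists_generic_point : exists u, generic_point u.
Proof.
pose I := {x : {set 'I_m} * 'I_m | ~~ (a x.2 <= span_mx x.1)%MS}.
have dat (x : I) : exists we : 'rV[R]_n * R, we.1 != 0 /\
    forall u q, (forall j, j \in (val x).1 -> h j q = 0) -> h (val x).2 q = 0 ->
      (u - q <= span_mx (val x).1)%MS -> dot we.1 u = we.2.
  case: x => -[S i] /= nS; have [c ce] := orthogonal_part (span_mx S) (a i).
  exists (a i - c *m span_mx S,
          b i - \sum_j c 0 j * (if j \in S then b j else 0)); split => /=.
    by apply: contra nS; rewrite subr_eq0 => /eqP->; exact: submxMl.
  move=> u q qS qi /submxP[d ud].
  have -> : u = q + d *m span_mx S by rewrite -ud subrKC.
  rewrite dotDr [X in _ + X]dotE trmx_mul mulmxA ce mul0mx mxE addr0.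
  rewrite dotDl dotNl; congr (_ - _).
    by move/eqP: qi; rewrite subr_eq0 => /eqP.
  rewrite dotE -mulmxA mxE; apply: eq_bigr => j _; congr (_ * _).
  rewrite -dot_row row_span_mx; case: ifP => jS; last first.
    by rewrite dotC dotE trmx0 mulmx0 mxE.
  by move/eqP: (qS _ jS); rewrite subr_eq0 => /eqP.
have [we weP] := choice dat.
have [u uP] := avoid_hyperplanes (w := fun x => (we x).1)
  (fun x => (we x).2) (fun x => (weP x).1).
exists u => S i q qS qi uq; apply/negPn/negP => nS.
pose x : I := exist _ (S, i) nS.
by have := uP x; rewrite (proj2 (weP x) _ _ qS qi uq) eqxx.
Qed.

End Generic.

Section Sweep.
Variables (R : realType) (n m : nat).
Variables (a : 'I_m -> 'rV[R]_n) (b : 'I_m -> R) (u : 'rV[R]_n).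
Local Notation h := (affine_form a b).
Local Notation dist2 x := (dot (x - u) (x - u)).

Definition nearest x q := closed_chamber a b xpredT x q /\
  forall y, closed_chamber a b xpredT x y -> dist2 q <= dist2 y.

Lemma nearest_exists x : exists q, nearest x q.
Proof.
have cl : closed (closed_chamber a b xpredT x) by exact: closed_chamber_closed.
have [|q Pq qmin] := exists_nearest u cl.
  by exists x => i _; rewrite -expr2 sqr_ge0.
by exists q.
Qed.

(** The direction r - q is feasible at q, so it makes a nonnegative product with q - u; as r is no
    farther from u than q, this forces r = q. The hyperplanes missing q then have both x and y on
    the side of q. *)
Lemma nearest_same_chamber x y q r :
  (forall i, h i x != 0) -> (forall i, h i y != 0) ->
  nearest x q -> nearest y r -> dist2 r <= dist2 q ->
  (forall i, h i q = 0 -> 0 < h i x * h i y) -> forall i, 0 < h i x * h i y.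
Proof.
move=> x0 y0 [Pq qmin] [Pr rmin] rq xy.
have v0 : 0 <= dot (q - u) (r - q).
  apply: (@nearest_feasible_dir _ _ _ a b xpredT x) => // i _ qi.
  rewrite (affine_form_sub a b) qi subr0.
  have : 0 <= (h i x * h i y) * (h i y * h i r).
    by rewrite mulr_ge0 ?(ltW (xy _ qi))// Pr.
  rewrite -mulrA (mulrA (h i y)) mulrCA pmulr_rge0//.
  by rewrite -expr2 exprn_even_gt0//=.
have {v0} qr : r = q.
  apply/eqP; rewrite -subr_eq0; apply/eqP/dot_eq0/eqP.
  rewrite eq_le dot_ge0 andbT.
  move: rq; rewrite -{1 2}(subrKC q r) -{1 2}[r - q]scale1r sqr_dist_line.
  lra.
rewrite {}qr in Pr; move=> i; have [/xy//|qi] := eqVneq (h i q) 0.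
apply: (@mul_gt0_trans _ (h i q)); rewrite lt_def mulf_neq0//= mulrC.
  exact: Pq.
exact: Pr.
Qed.

(** If q were nearest to u in the larger region bounded by [J] only, then u - q would lie in the
    span of the normals of [S], and genericity would put a_i0 in this span. *)
Lemma generic_closer x q (J : {set 'I_m}) i0 : generic_point a b u ->
  (forall i, h i x != 0) -> closed_chamber a b xpredT x q -> h i0 q = 0 ->
  ~~ (a i0 <= span_mx a [set i in J | h i q == 0])%MS ->
  exists y, [/\ forall i, h i y != 0, dist2 y < dist2 q &
    forall i, i \in J -> 0 < h i x * h i y].
Proof.
move=> gen x0 Pq q0 nspan; set S := [set i in J | _] in nspan.
have [z Pz zq] : exists2 z, closed_chamber a b (mem J) x z & dist2 z < dist2 q.
  apply: contrapT => nz.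
  have qmin z : closed_chamber a b (mem J) x z -> dist2 q <= dist2 z.
    by move=> Pz; rewrite leNgt; apply/negP => zq; apply: nz; exists z.
  have PJ : closed_chamber a b (mem J) x q by move=> i _; exact: Pq.
  apply: (negP nspan); apply: (gen _ _ q) => // [j|].
    by rewrite inE => /andP[_ /eqP].
  rewrite submxE; apply/eqP/rowP => j; rewrite [RHS]mxE.
  set K := cokermx _; pose v := (col j K)^T.
  have Sv i : i \in S -> dot (a i) v = 0.
    move=> iS; have := dot_row (span_mx a S) i v; rewrite row_span_mx iS => ->.
    by rewrite trmxK colE mulmxA mulmx_coker mul0mx mxE.
  (* A vector orthogonal to the normals of [S] is feasible in both directions, so it is orthogonal
     to q - u. *)
  have dir w : w = v \/ w = - v -> 0 <= dot (q - u) w.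
    move=> wv; apply: (@nearest_feasible_dir _ _ _ a b (mem J) x) => // i iJ qi.
    have /Sv av : i \in S by rewrite inE qi eqxx andbT; exact: iJ.
    by case: wv => ->; rewrite ?dotNr av ?oppr0 mulr0.
  have dv : dot (q - u) v = 0.
    apply/eqP; rewrite eq_le dir ?andbT; last by left.
    by rewrite -oppr_ge0 -dotNr dir//; right.
  transitivity (dot (u - q) v); last by rewrite -opprB dotNl dv oppr0.
  rewrite dotE trmxK [LHS]mxE [RHS]mxE; apply: eq_bigr => l _.
  by rewrite [X in _ = _ * X]mxE.
(* The point z may lie on hyperplanes. A short step towards x leaves them all and stays closer to u
   than q; by convexity it is strictly on the side of x for [J]. *)
pose y (e : R) := z + e *: (x - z).
have hy e i : h i (y e) = h i z + e * (h i x - h i z).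
  by rewrite affine_form_line (affine_form_sub a b).
have near1 : \forall e \near 0^'+, forall i, h i (y e) != 0.
  apply: filter_forall => i; have [zi|zi] := eqVneq (h i z) 0.
    apply: filterS (nbhs_right_gt 0) => e e0.
    by rewrite hy zi subr0 add0r mulf_neq0// gt_eqF.
  have zz : 0 < h i z * h i z by rewrite -expr2 exprn_even_gt0//=.
  apply: filterS (near_right_gt0 ((h i x - h i z) * h i z) zz) => e.
  by rewrite mulrA -mulrDl -hy; apply: contraTneq => ->; rewrite mul0r ltxx.
have near2 : \forall e \near 0^'+, 0 < (dist2 q - dist2 z) +
    e * - (2 * dot (z - u) (x - z) + dot (x - z) (x - z)).
  by apply: near_right_gt0; rewrite subr_gt0.
have near3 : \forall e \near 0^'+, 0 < e < (1 : R).
  apply: filterS2 (nbhs_right_gt 0) (nbhs_right_lt (@ltr01 R)) => e -> ->.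
  by [].
have [e [[e1 e2] /andP[e0 e3]]] :=
  @filter_ex _ _ (@at_right_proper_filter R 0) _ (filterI (filterI near1 near2) near3).
exists (y e); split=> [||i iJ]; first exact: e1.
  rewrite /y sqr_dist_line; have := dot_ge0 (x - z).
  move: e2; move: (dot (x - z) (x - z)) => ww; move: (dot _ (x - z)) => zw.
  move: (dist2 q) (dist2 z) => A B h1 h2.
  have : e * (e * ww) <= e * ww by rewrite ler_pM2l// ler_piMl// ltW.
  lra.
rewrite hy (_ : _ * _ = (1 - e) * (h i x * h i z) + e * (h i x * h i x)); last ring.
apply: ltr_wpDl; last by rewrite mulr_gt0// -expr2 exprn_even_gt0//=.
apply: mulr_ge0; first by rewrite subr_ge0 ltW.
exact: Pz.
Qed.

End Sweep.

(** * Chambers and the sweep *)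

Lemma hyperplane_inj (R : realType) (n : nat) (a a' : 'rV[R]_n) (b b' : R) :
  a != 0 -> hyperplane a b = hyperplane a' b' ->
  exists c, a' = c *: a /\ b' = c * b.
Proof.
move=> a0 H; have aa : dot a a != 0 by apply: contra a0 => /eqP/dot_eq0->.
pose x := (b / dot a a) *: a.
have on v : dot a v = 0 -> dot a' (x + v) = b'.
  move=> av; suff : hyperplane a' b' (x + v) by [].
  by rewrite -H; change (dot a (x + v) = b); rewrite dotDr av addr0 dotZr divfK.
have xb' : dot a' x = b' by rewrite -(on 0) ?addr0// dotE trmx0 mulmx0 mxE.
have perp v : dot a v = 0 -> dot a' v = 0.
  by move/on; rewrite dotDr xb' -[RHS]addr0 => /addrI.
pose c := dot a' a / dot a a; exists c.
have a'E : a' = c *: a.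
  apply/eqP; rewrite -subr_eq0; apply/eqP/dot_eq0.
  have cp : dot a (a' - c *: a) = 0.
    by rewrite dotDr dotNr dotZr divfK// (dotC a') subrr.
  by rewrite dotDl dotNl dotZl cp mulr0 subr0 perp.
by split => //; rewrite -xb' {1}a'E dotZl dotZr mulrC divfK// mulrC.
Qed.

Lemma linear_polyZ (R : realType) (n : nat) c (a : 'rV[R]_n) b :
  linear_poly (c *: a) (c * b) = c *: linear_poly a b.
Proof.
rewrite /linear_poly scalerBr scaler_sumr -mul_mpolyC -mpolyCM; congr (_ - _).
by apply: eq_bigr => i _; rewrite mxE scalerA.
Qed.

Lemma linear_poly0 (R : realType) (n : nat) : linear_poly (0 : 'rV[R]_n) 0 = 0.
Proof.
by rewrite -[0 in RHS](scale0r (linear_poly 0 0)) -linear_polyZ scaler0 mul0r.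
Qed.

(** Both sides have the linear part c M and vanish at q. *)
Lemma linear_poly_lincomb (R : realType) (n m : nat) (M : 'M[R]_(m, n))
    (q c : 'rV[_]_ _) :
  linear_poly (c *m M) (dot (c *m M) q) =
  \sum_r c 0 r *: linear_poly (row r M) ((q *m M^T) 0 r).
Proof.
rewrite /linear_poly; under [RHS]eq_bigr => r _ do rewrite scalerBr scaler_sumr.
rewrite sumrB exchange_big /=; congr (_ - _).
  apply: eq_bigr => i _; rewrite mxE scaler_suml; apply: eq_bigr => r _.
  by rewrite scalerA mxE.
under [RHS]eq_bigr => r _ do rewrite -mul_mpolyC -mpolyCM.
rewrite -raddf_sum /=; congr (_%:MP).
rewrite dotE -mulmxA mxE; apply: eq_bigr => r _; congr (_ * _).
by rewrite -dot_row dotC dotE !mxE; apply: eq_bigr => l _; rewrite !mxE.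
Qed.

Lemma linear_poly_row_span (R : realType) (n m : nat) (a : 'I_m -> 'rV[R]_n)
    (b : 'I_m -> R) (S : {set 'I_m}) (q : 'rV[R]_n) r :
  (forall i, i \in S -> affine_form a b i q = 0) ->
  linear_poly (row r (span_mx a S)) ((q *m (span_mx a S)^T) 0 r) =
  if r \in S then linear_poly (a r) (b r) else 0.
Proof.
move=> qS; have -> : (q *m (span_mx a S)^T) 0 r = dot (row r (span_mx a S)) q.
  by rewrite dot_row !mxE; apply: eq_bigr => l _; rewrite !mxE mulrC.
rewrite row_span_mx; case: ifP => [/qS/eqP|_].
  by rewrite subr_eq0 => /eqP ->.
by rewrite dotC dotE trmx0 mulmx0 mxE linear_poly0.
Qed.

Lemma hyperplane_locusE (R : realType) (n : nat) (a : 'rV[R]_n) b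
    (p : prime_spectrum {mpoly R[n]}) : a != 0 ->
  hyperplane_locus (hyperplane a b) p <-> linear_poly a b \in p.
Proof.
move=> a0; split=> [|abp]; first by apply; exists a, b.
move=> _ [a' [b' [_ H ->]]]; have [c [-> ->]] := hyperplane_inj a0 H.
by rewrite linear_polyZ -mul_mpolyC primeMl.
Qed.

Lemma arrangement_equations (R : realType) (n : nat) (A : arrangement R n) :
  exists m (a : 'I_m -> 'rV[R]_n) (b : 'I_m -> R), (forall i, a i != 0) /\
    hyperplanes A = [set H | exists i, H = hyperplane (a i) (b i)].
Proof.
have /finite_seqP[s sE] := arrangement_finite A.
have eqn (i : 'I_(size s)) : exists ab : 'rV[R]_n * R,
    ab.1 != 0 /\ tnth (in_tuple s) i = hyperplane ab.1 ab.2.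
  have [|a [b [a0 H]]] := @arrangementP _ _ A (tnth (in_tuple s) i).
    by rewrite sE /= mem_tnth.
  by exists (a, b).
have [f fP] := choice eqn.
exists (size s), (fun i => (f i).1), (fun i => (f i).2).
split=> [i|]; first by have [] := fP i.
rewrite sE; apply/seteqP; split=> H /=.
  by move=> /(tnthP (in_tuple s))[i ->]; exists i; have [] := fP i.
by move=> [i ->]; have [_ <-] := fP i; rewrite mem_tnth.
Qed.

Section Chambers.
Variables (R : realType) (n : nat) (A : arrangement R n) (m : nat).
Variables (a : 'I_m -> 'rV[R]_n) (b : 'I_m -> R).
Hypothesis a0 : forall i, a i != 0.
Hypothesis AE : hyperplanes A = [set H | exists i, H = hyperplane (a i) (b i)].
Local Notation h := (affine_form a b).

Lemma hyperplane_affine_form i x : hyperplane (a i) (b i) x <-> h i x = 0.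
Proof.
split=> [Hx|/eqP]; last by rewrite subr_eq0 => /eqP.
by apply/eqP; rewrite subr_eq0; apply/eqP; exact: Hx.
Qed.

Lemma complementE : complement A = [set x | forall i, h i x != 0].
Proof.
apply/seteqP; split=> x /= hx.
  move=> i; apply/eqP => /hyperplane_affine_form Hx.
  by apply: hx; exists (hyperplane (a i) (b i)) => //; rewrite AE; exists i.
move=> [H]; rewrite AE => -[i ->] /hyperplane_affine_form/eqP; exact/negP/hx.
Qed.

Lemma components_hyperplane i x : h i x != 0 ->
  connected_component (~` hyperplane (a i) (b i)) x = [set y | 0 < h i x * h i y].
Proof.
(* A single hyperplane is treated as a family indexed by [unit]. *)
move=> hx; rewrite (_ : ~` _ = [set y | forall _ : unit,
    affine_form (fun=> a i) (fun=> b i) tt y != 0]).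
  rewrite connected_component_signs//; apply/seteqP; split=> y /=.
    by move=> /(_ tt).
  by move=> hy [].
apply/seteqP; split=> y /= hy; first by move=> _; apply/eqP => /hyperplane_affine_form.
by move=> /hyperplane_affine_form/eqP; exact/negP/hy.
Qed.

Lemma chamber_signs (C : chamber A) : exists x, (forall i, h i x != 0) /\
  set_val C = [set y | forall i, 0 < h i x * h i y].
Proof.
have [x cx e] := set_mem (valP C).
have hx i : h i x != 0 by move: cx; rewrite complementE; exact.
by exists x; split => //; rewrite -connected_component_signs// -complementE e.
Qed.

Variable pt : chamber A -> 'rV[R]_n.
Hypothesis pt0 : forall C i, h i (pt C) != 0.
Hypothesis ptE : forall C, set_val C = [set y | forall i, 0 < h i (pt C) * h i y].

Lemma chamber_eqP (C D : chamber A) :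
  (forall i, 0 < h i (pt C) * h i (pt D)) -> C = D.
Proof.
move=> CD; apply/val_inj; change (set_val C = set_val D); rewrite !ptE.
apply/seteqP; split=> y /= hy i; have := hy i; have := CD i.
  exact: mul_gt0_trans.
by rewrite mulrC; exact: mul_gt0_trans.
Qed.

Lemma chamber_containing y : (forall i, h i y != 0) ->
  exists D : chamber A, forall i, 0 < h i y * h i (pt D).
Proof.
move=> hy; have Dy : components (complement A) (connected_component (complement A) y).
  by exists y => //; rewrite complementE.
exists (SigSub (mem_set Dy)).
have : set_val (SigSub (mem_set Dy) : chamber A) y.
  by apply: connected_component_refl; rewrite complementE.
by rewrite ptE => hD i; rewrite mulrC; exact: hD.
Qed.

Lemma chamber_finite : finite_set [set: chamber A].
Proof.
pose f (C : chamber A) : {set 'I_m} := finset (fun i => 0 < h i (pt C)).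
have -> : [set: chamber A] = f @^-1` setT by [].
apply: finite_preimage => // C D _ _ fCD; apply: chamber_eqP => i.
have : (i \in f C) = (i \in f D) by rewrite fCD.
rewrite !inE; have := pt0 C i; have := pt0 D i.
have [Di|Di|//] := ltgtP (h i (pt D)) 0; have [Ci|Ci|//] := ltgtP (h i (pt C)) 0 => //.
  by rewrite nmulr_rgt0.
by rewrite pmulr_rgt0.
Qed.

Lemma Sep_signs (C D : chamber A) H : Sep A (set_val C) (set_val D) H <->
  exists i, H = hyperplane (a i) (b i) /\ h i (pt C) * h i (pt D) < 0.
Proof.
have ptC (E : chamber A) : set_val E (pt E).
  by rewrite ptE => i; rewrite -expr2 exprn_even_gt0//=.
split.
  rewrite /Sep AE => -[[i ->] [K [L [[x hx KE] [y hy LE] CK DL KL]]]].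
  exists i; split => //.
  rewrite ltNge le_eqVlt; apply/negP => /orP[|CD].
    by rewrite eq_sym mulf_eq0 (negPf (pt0 _ _)) (negPf (pt0 _ _)).
  apply: KL; rewrite -KE -LE.
  have := CK _ (ptC C); rewrite -KE => /same_connected_component ->.
  have := DL _ (ptC D); rewrite -LE => /same_connected_component ->.
  by apply: same_connected_component; rewrite components_hyperplane.
move=> [i [-> CD]]; split; first by rewrite AE; exists i.
have nH (E : chamber A) : (~` hyperplane (a i) (b i)) (pt E).
  by move=> /hyperplane_affine_form/eqP; exact/negP/pt0.
exists (connected_component (~` hyperplane (a i) (b i)) (pt C)).
exists (connected_component (~` hyperplane (a i) (b i)) (pt D)).
split; [by exists (pt C)|by exists (pt D)| | |].
- by rewrite ptE components_hyperplane// => y; exact.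
- by rewrite ptE components_hyperplane// => y; exact.
rewrite !components_hyperplane// => /seteqP[_ /(_ (pt D))] /=.
by rewrite -expr2 exprn_even_gt0//= => /(_ (pt0 _ _)); rewrite ltNge ltW.
Qed.

Lemma chamber_overlapE (C D : chamber A) (p : prime_spectrum {mpoly R[n]}) :
  chamber_overlap C D p <-> forall i, h i (pt C) * h i (pt D) < 0 ->
    linear_poly (a i) (b i) \notin p.
Proof.
split=> [CDp i CD|CDp [H /Sep_signs[i [-> CD]]]].
  apply/negP => lp; apply: CDp; exists (hyperplane (a i) (b i)).
    by apply/Sep_signs; exists i.
  exact/hyperplane_locusE.
move=> /(hyperplane_locusE _ _ (a0 i)); exact/negP/CDp.
Qed.

End Chambers.

(** The implication from left to right uses [generic_closer], with the hyperplanes through p as [J];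
    the converse uses [nearest_same_chamber]. The hypotheses on [earlier] hold in any list without
    repetitions sorted by distance, whatever the order among ties. *)
Lemma sweep_stratum (R : realType) (n m : nat) (A : arrangement R n)
    (a : 'I_m -> 'rV[R]_n) (b : 'I_m -> R) (u : 'rV[R]_n)
    (pt q : chamber A -> 'rV[R]_n) (earlier : chamber A -> Prop) (C : chamber A)
    (p : prime_spectrum {mpoly R[n]}) :
  (forall i, a i != 0) ->
  hyperplanes A = [set H | exists i, H = hyperplane (a i) (b i)] ->
  (forall D i, affine_form a b i (pt D) != 0) ->
  (forall D, set_val D =
    [set y | forall i, 0 < affine_form a b i (pt D) * affine_form a b i y]) ->
  generic_point a b u ->
  (forall D, nearest a b u (pt D) (q D)) ->
  (forall D, earlier D -> D <> C) ->
  (forall D, earlier D ->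
    dot (q D - u) (q D - u) <= dot (q C - u) (q C - u)) ->
  (forall D, dot (q D - u) (q D - u) < dot (q C - u) (q C - u) -> earlier D) ->
  (forall D, earlier D -> ~ chamber_overlap D C p) <->
  (forall i, affine_form a b i (q C) = 0 -> linear_poly (a i) (b i) \in p).
Proof.
move=> a0 AE pt0 ptE gen qP eC eD De; set h := affine_form a b in pt0 ptE *.
split=> [noD i0 qi0|pq D De' /(chamber_overlapE a0 AE pt0 ptE) CDp].
  apply/negPn/negP => li0.
  pose J : {set 'I_m} := finset (fun i => linear_poly (a i) (b i) \in p).
  pose S := finset (fun i => (i \in J) && (h i (q C) == 0)).
  (* All these equations vanish at q_C, so a linear relation between the normals is also one between
     the equations, and the equation of i0 would lie in p. *)
  have nspan : ~~ (a i0 <= span_mx a S)%MS.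
    apply: contra li0 => /submxP[c ac].
    have -> : b i0 = dot (a i0) (q C).
      by apply/esym/eqP; rewrite -subr_eq0; apply/eqP.
    rewrite ac linear_poly_lincomb.
    elim/big_ind: _ => [|x y|r _]; [exact: prime0|exact: primeD|].
    rewrite -mul_mpolyC primeMl// (linear_poly_row_span (b := b)) => [|i].
      by case: ifP => [|_]; [rewrite !inE => /andP[]|rewrite prime0].
    by rewrite inE => /andP[_ /eqP].
  (* The chamber D of y is earlier than C, and no hyperplane through p separates the two, so p lies
     in their overlap. *)
  have [y [y0 yC Jy]] := generic_closer gen (pt0 C) (proj1 (qP C)) qi0 nspan.
  have [D yD] := chamber_containing AE ptE y0.
  apply: (noD D).
    apply: De; apply: le_lt_trans yC; apply: (proj2 (qP D)) => i _.
    by rewrite mulrC ltW ?yD.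
  apply/(chamber_overlapE a0 AE pt0 ptE) => i DC; apply/negP => lp.
  have Ci : 0 < h i (pt C) * h i y by apply: Jy; rewrite inE.
  have : 0 < h i (pt C) * h i (pt D).
    by apply: mul_gt0_trans (yD i); rewrite mulrC.
  by rewrite mulrC ltNge (ltW DC).
(* Every hyperplane through q_C passes through p, so none separates D from C, and D would be C. *)
apply: (eC _ De'); apply/esym/(chamber_eqP ptE).
apply: (nearest_same_chamber (pt0 C) (pt0 D) (qP C) (qP D) (eD _ De')) => i qi.
rewrite ltNge le_eqVlt; apply/negP => /orP[|DC].
  by rewrite mulf_eq0 (negPf (pt0 _ _)) (negPf (pt0 _ _)).
by have := CDp i; rewrite mulrC => /(_ DC)/negP; apply; exact: pq.
Qed.

Theorem corollary3p5p8 (R : realType) (n : nat) (A : arrangement R n) :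
  has_cell_decomposition (arrangement_scheme A).
Proof.
have [m [a [b [a0 AE]]]] := arrangement_equations A.
have [pt /all_and2[pt0 ptE]] := choice (chamber_signs AE).
have [u gen] := exists_generic_point a b.
have [q qP] := choice (fun C => nearest_exists a b u (pt C)).
pose d C := dot (q C - u) (q C - u).
have /finite_seqP[s0 s0E] := chamber_finite pt0 ptE.
pose le_d : rel (chamber A) := fun C D => d C <= d D.
(* Repetitions are removed so that no chamber precedes itself. *)
pose s := sort le_d (undup s0).
have s_all C : C \in s.
  by rewrite mem_sort mem_undup; have : [set` s0] C by rewrite -s0E.
have s_uniq : uniq s by rewrite sort_uniq undup_uniq.
have s_sorted : pairwise le_d s.
  rewrite -sorted_pairwise; last by move=> C D F; exact: le_trans.
  by apply: sort_sorted => C D; exact: le_total.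
pose W := arrangement_gluing A.
pose U j : set (glue W) :=
  \bigcup_(C in [set` take j s]) (chart C : set (glue W)).
exists (size s), U; split.
- by move=> j _; apply: bigcup_open => C _; exact: chart_open.
- by rewrite /U take0; apply/seteqP; split=> // x [].
- apply/seteqP; split=> // x _; have [C [p ->]] := in_glue_surj x.
  by exists C; [rewrite /= take_size s_all|exists p].
- move=> j js x [C /= Cj Cx]; exists C => //=.
  by move: Cj; rewrite -(take_takel s (leqnSn j)) => /mem_take.
move=> j js.
have [C sE] : exists C, s = take j s ++ C :: drop j.+1 s.
  case: s js {s_all s_uniq s_sorted U} => // C0 s' js.
  by exists (nth C0 (C0 :: s') j); rewrite -drop_nth// cat_take_drop.
have takeS : take j.+1 s = rcons (take j s) C.
  rewrite {1}sE take_cat size_take js ltnNge leqnSn /= subSnn /= take0.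
  by rewrite cats1.
move: s_uniq s_sorted; rewrite {1 2}sE cat_uniq pairwise_cat /=.
move=> /and3P[_ /norP[Cj _] _] /and3P[lej _ /andP[leC _]].
(* The hyperplanes through q_C: they cut out the flat that the chart of C adds. *)
pose S := finset (fun i => affine_form a b i (q C) == 0).
have [e [f [g [g_alg fK fgP]]]] := flat_retraction (span_mx a S) (q C).
exists e.
have dom (P Q : {mpoly R[e]}) : P * Q = 0 -> P = 0 \/ Q = 0.
  by move/eqP; rewrite mulf_eq0 => /orP[] /eqP; [left|right].
apply: (@glue_stratum_iso R {mpoly R[n]} {mpoly R[e]} f g g_alg fK dom _ W C).
  apply/seteqP; split=> x.
    move=> [D /=]; rewrite takeS mem_rcons inE => /orP[/eqP->|Dj] Dx; [by right|left].
    by exists D.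
  move=> [[D /= Dj] Dx|Cx]; [exists D|exists C] => //=;
    by rewrite takeS mem_rcons inE ?Dj ?orbT ?eqxx.
move=> p; apply: (iff_trans _ (fgP p)).
pose earlier D := D \in take j s.
have qPj : (forall D, earlier D -> ~ chamber_overlap D C p) <->
    forall i, affine_form a b i (q C) = 0 -> linear_poly (a i) (b i) \in p.
  apply: (sweep_stratum p a0 AE pt0 ptE gen qP).
  - by move=> D Dj DC; move: Cj; rewrite -DC; exact/negP/negPn.
  - move=> D Dj; move/allrelP: lej => /(_ D C Dj); apply.
    by rewrite inE eqxx.
  (* In the sorted list, a chamber strictly closer than C is neither C nor after C. *)
  - move=> D; rewrite ltNge => /negP DC; apply: contrapT => /negP.
    rewrite /earlier => Dj.
    apply: DC; have := s_all D; rewrite sE mem_cat (negPf Dj) /= inE.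
    by move=> /orP[/eqP->//|Dr]; exact: (allP leC).
(* A point of the chart of C is already covered exactly when it lies in the overlap with an earlier
   chart. *)
apply: (iff_trans (B := forall D, earlier D -> ~ chamber_overlap D C p)).
  split=> [nU D Dj DC|noD [D /= Dj] [p' _ /in_glue_eq[pp' DC]]].
    by apply: nU; exists D => //; exists p => //; apply/in_glue_eq.
  by apply: (noD D Dj); rewrite -pp'.
apply: (iff_trans qPj).
(* The zero rows outside [S] give the zero polynomial, which lies in every prime. *)
have rowE r : linear_poly (row r (span_mx a S)) ((q C *m (span_mx a S)^T) 0 r) =
    if r \in S then linear_poly (a r) (b r) else 0.
  by apply: linear_poly_row_span => i; rewrite inE => /eqP.
split=> [h r|h i qi]; last by have := h i; rewrite rowE inE qi eqxx.
by rewrite rowE; case: ifP => [|_]; [rewrite inE => /eqP/h|rewrite prime0].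
Qed.
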